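(* For every $\lambda_{\mathsf{letrec}}$-term $L$ the following are equivalent: (i) $L$ expresses an infinite $\lambda$-term; (ii) $\lambda.L$ is derivable in $\mathbf{Reg}^{+}_{\mathsf{letrec}}$.
   Context: $\lambda_{\mathsf{letrec}}$-terms are finite terms $L::=x\mid \lambda x.L\mid L\,L\mid \mathsf{letrec}\ f_1=L_1,\dots,f_n=L_n\ \mathsf{in}\ L$, with recursion variables $f_i$ bound in all $L_j$, modulo $\alpha$. $L$ expresses (unfolds to) an infinite $\lambda$-term $M$ (a possibly infinite term built from variables, abstractions and applications, modulo $\alpha$) if there is a strongly convergent, possibly infinite rewrite sequence from $L$ to $M$ in the letrec-unfolding rewrite system (which pushes $\mathsf{letrec}$-bindings into abstractions and applications, replaces an occurrence of a recursion variable $f_i$ in the scope of $\mathsf{letrec}\ f_1=L_1,\dots,f_n=L_n$ by $L_i$, merges nested $\mathsf{letrec}$s, and removes unused bindings and empty $\mathsf{letrec}$s). A prefixed term is $\lambda x_1\ldots x_n.L$ ($n\ge0$; $\lambda.L$ for empty prefix) with the free variables of $L$ among the $x_i$; terms may contain fresh constants $\mathsf{c}$. Proof system $\mathbf{Reg}^{+}_{\mathsf{letrec}}$ (finite natural-deduction trees of prefixed terms): axiom $\lambda\vec{x}y.y$; $(\lambda)$: from $\lambda\vec{x}y.L_0$ infer $\lambda\vec{x}.\lambda y.L_0$; $(@)$: from $\lambda\vec{x}.L_0$ and $\lambda\vec{x}.L_1$ infer $\lambda\vec{x}.(L_0\,L_1)$; $(\mathrm{del}^+)$: from $\lambda x_1\ldots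 x_{n-1}.L$ infer $\lambda x_1\ldots x_n.L$ if $x_n$ not free in $L$; $(\mathrm{FIX}_{\mathsf{letrec}})$: for distinct constants $\mathsf{c}_{f_1},\dots,\mathsf{c}_{f_n}$ fresh for $L_1,\dots,L_{n+1}$, from derivations $\mathcal{D}_j$ ($1\le j\le n+1$) of $\lambda\vec{x}.L_j[f_1:=\mathsf{c}_{f_1},\dots,f_n:=\mathsf{c}_{f_n}]$, possibly with open assumption leaves $[\lambda\vec{x}.\mathsf{c}_{f_i}]^{u_i}$, infer $\lambda\vec{x}.\,\mathsf{letrec}\ f_1=L_1,\dots,f_n=L_n\ \mathsf{in}\ L_{n+1}$, discharging them; side conditions: (1) every $\lambda\vec{y}.N$ on a thread in some $\mathcal{D}_j$ from an open assumption $(\lambda\vec{x}.\mathsf{c}_{f_i})^{u_i}$ downwards has $|\vec{y}|\ge|\vec{x}|$; (2) for a bottommost instance, the derivation ending in it is guarded on access path cycles. An access path is a possibly cyclic path from the conclusion upwards that at $(\lambda)$, $(\mathrm{del}^+)$ moves to the premise, at $(@)$ to either premise, at $(\mathrm{FIX}_{\mathsf{letrec}})$ to the rightmost premise, and on reaching a marked assumption $(\lambda\vec{x}.\mathsf{c}_{f_i})^{u_i}$ continues at the conclusion of the subderivation $\mathcal{D}_i$ of the instance discharging it; guarded on access path cycles means every cycle of every access path contains an instance of $(\lambda)$ or $(@)$. Derivable means: a finite derivation in which all marked assumptions are discharged. *)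

(* Defs.v *)
From Stdlib Require Import List Arith Relations.
Import ListNotations.

(* Terms.  Two separate de Bruijn index spaces:
   - [Var i]     : lambda-variable, bound by the i-th enclosing [Lam]
                   (letrec does not bind lambda-variables);
   - [RVar k i]  : recursion variable f_{i+1} of the k-th enclosing [Letrec]
                   (lambda does not bind recursion variables);
   - [Letrec bs b] : letrec f_1 = bs_1, ..., f_n = bs_n in b, the f_i being
                   bound in all bs_j and in b;
   - [Cst c]     : constants (only used inside the proof system). *)
Inductive term : Type :=
| Var (i : nat)
| Lam (t : term)
| App (t u : term)
| RVar (k i : nat)
| Letrec (bs : list term) (b : term)
| Cst (c : nat).

Fixpoint lshift (c : nat) (t : term) : term :=
  match t with
  | Var i => Var (if c <=? i then S i else i)
  | Lam u => Lam (lshift (S c) u)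
  | App u v => App (lshift c u) (lshift c v)
  | RVar k i => RVar k i
  | Letrec bs b => Letrec (map (lshift c) bs) (lshift c b)
  | Cst x => Cst x
  end.

Fixpoint lclosedb (n : nat) (t : term) : bool :=
  match t with
  | Var i => i <? n
  | Lam u => lclosedb (S n) u
  | App u v => lclosedb n u && lclosedb n v
  | RVar _ _ => true
  | Letrec bs b => forallb (lclosedb n) bs && lclosedb n b
  | Cst _ => true
  end.

(* recursion variables well scoped; [ks] lists the binding counts of the
   enclosing letrecs, innermost first *)
Fixpoint rscopedb (ks : list nat) (t : term) : bool :=
  match t with
  | Var _ => true
  | Lam u => rscopedb ks u
  | App u v => rscopedb ks u && rscopedb ks v
  | RVar k i => match nth_error ks k with Some m => i <? m | None => false end
  | Letrec bs b =>
      forallb (rscopedb (length bs :: ks)) bs && rscopedb (length bs :: ks) b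
  | Cst _ => true
  end.

Fixpoint hasc (c : nat) (t : term) : bool :=
  match t with
  | Var _ => false
  | Lam u => hasc c u
  | App u v => hasc c u || hasc c v
  | RVar _ _ => false
  | Letrec bs b => existsb (hasc c) bs || hasc c b
  | Cst x => c =? x
  end.

Fixpoint rocc (lvl i : nat) (t : term) : bool :=
  match t with
  | Var _ => false
  | Lam u => rocc lvl i u
  | App u v => rocc lvl i u || rocc lvl i v
  | RVar k j => (k =? lvl) && (j =? i)
  | Letrec bs b => existsb (rocc (S lvl) i) bs || rocc (S lvl) i b
  | Cst _ => false
  end.

Fixpoint rrename (lvl : nat) (f : nat -> nat) (t : term) : term :=
  match t with
  | Var i => Var i
  | Lam u => Lam (rrename lvl f u)
  | App u v => App (rrename lvl f u) (rrename lvl f v)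
  | RVar k i => if k =? lvl then RVar k (f i) else RVar k i
  | Letrec bs b => Letrec (map (rrename (S lvl) f) bs) (rrename (S lvl) f b)
  | Cst x => Cst x
  end.

Fixpoint runshift (lvl : nat) (t : term) : term :=
  match t with
  | Var i => Var i
  | Lam u => Lam (runshift lvl u)
  | App u v => App (runshift lvl u) (runshift lvl v)
  | RVar k i => if lvl <? k then RVar (k - 1) i else RVar k i
  | Letrec bs b => Letrec (map (runshift (S lvl)) bs) (runshift (S lvl) b)
  | Cst x => Cst x
  end.

(* merge an inner letrec (relative level lvl) into the outer one (level lvl+1)
   that has n bindings: inner f_i becomes outer f_{n+i} *)
Fixpoint merge_inner (n lvl : nat) (t : term) : term :=
  match t with
  | Var i => Var i
  | Lam u => Lam (merge_inner n lvl u)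
  | App u v => App (merge_inner n lvl u) (merge_inner n lvl v)
  | RVar k i =>
      if k =? lvl then RVar lvl (n + i)
      else if k =? S lvl then RVar lvl i
      else if S lvl <? k then RVar (k - 1) i
      else RVar k i
  | Letrec bs b => Letrec (map (merge_inner n (S lvl)) bs) (merge_inner n (S lvl) b)
  | Cst x => Cst x
  end.

Fixpoint rsubst (cs : list nat) (lvl : nat) (t : term) : term :=
  match t with
  | Var i => Var i
  | Lam u => Lam (rsubst cs lvl u)
  | App u v => App (rsubst cs lvl u) (rsubst cs lvl v)
  | RVar k i =>
      if k =? lvl then
        match nth_error cs i with Some c => Cst c | None => RVar k i end
      else if lvl <? k then RVar (k - 1) i
      else RVar k i
  | Letrec bs b => Letrec (map (rsubst cs (S lvl)) bs) (rsubst cs (S lvl) b)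
  | Cst x => Cst x
  end.

Definition closed_letrec_term (t : term) : Prop :=
  lclosedb 0 t = true /\ rscopedb [] t = true /\ (forall c, hasc c t = false).

Definition gc_keep (keep : list bool) (bs : list term) : list term :=
  map snd (filter fst (combine keep bs)).
Definition gc_map (keep : list bool) (i : nat) : nat :=
  count_occ Bool.bool_dec (firstn i keep) true.

Inductive root_step : term -> term -> Prop :=
| rs_lam bs L :
    root_step (Letrec bs (Lam L)) (Lam (Letrec (map (lshift 0) bs) L))
| rs_app bs L0 L1 :
    root_step (Letrec bs (App L0 L1)) (App (Letrec bs L0) (Letrec bs L1))
| rs_rec bs i Li :
    nth_error bs i = Some Li ->
    root_step (Letrec bs (RVar 0 i)) (Letrec bs Li)
| rs_nest bs bs' L :
    root_step (Letrec bs (Letrec bs' L))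
      (Letrec (bs ++ map (merge_inner (length bs) 0) bs')
              (merge_inner (length bs) 0 L))
| rs_gc bs L keep :
    length keep = length bs ->
    In false keep ->
    (forall i, nth i keep true = false ->
       rocc 0 i L = false /\
       forall j b, nth_error bs j = Some b -> nth j keep true = true ->
                   rocc 0 i b = false) ->
    root_step (Letrec bs L)
      (Letrec (map (rrename 0 (gc_map keep)) (gc_keep keep bs))
              (rrename 0 (gc_map keep) L))
| rs_nil L :
    root_step (Letrec [] L) (runshift 0 L).

Inductive step : nat -> term -> term -> Prop :=
| st_root t u : root_step t u -> step 0 t u
| st_lam d t u : step d t u -> step (S d) (Lam t) (Lam u)
| st_appl d t u v : step d t u -> step (S d) (App t v) (App u v)
| st_appr d t u v : step d t u -> step (S d) (App v t) (App v u)
| st_bind d bs1 b b' bs2 L :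
    step d b b' -> step (S d) (Letrec (bs1 ++ b :: bs2) L) (Letrec (bs1 ++ b' :: bs2) L)
| st_body d bs L L' : step d L L' -> step (S d) (Letrec bs L) (Letrec bs L').

CoInductive iterm : Type :=
| IVar (i : nat)
| ILam (t : iterm)
| IApp (t u : iterm).

Fixpoint agree (d : nat) (t : term) (M : iterm) : Prop :=
  match d with
  | 0 => True
  | S d' =>
      match t, M with
      | Var i, IVar j => i = j
      | Lam t', ILam M' => agree d' t' M'
      | App t1 t2, IApp M1 M2 => agree d' t1 M1 /\ agree d' t2 M2
      | _, _ => False
      end
  end.

(* L expresses M: a finite rewrite sequence ending in (a finite term equal to) M,
   or a strongly convergent rewrite sequence of length omega with limit M. *)
Definition expresses (L : term) (M : iterm) : Prop :=
  (exists t, clos_refl_trans term (fun a b => exists d, step d a b) L t /\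
             forall d, agree d t M)
  \/
  (exists (t : nat -> term) (dep : nat -> nat),
      t 0 = L /\
      (forall i, step (dep i) (t i) (t (S i))) /\
      (forall D, exists N, forall i, N <= i -> D <= dep i) /\
      (forall D, exists N, forall i, N <= i -> agree D (t i) M)).

(* Proof system Reg+_letrec.  A prefixed term lambda x_1..x_n.L is the pair
   (n, L) with L's free lambda-variables among the n prefix variables (x_n is
   de Bruijn index 0). *)
Inductive rule : Type :=
| RAx
| RAssm (c : nat)
| RLam
| RApp
| RDel
| RFix (cs : list nat).

Inductive deriv : Type :=
| Node (r : rule) (n : nat) (L : term) (kids : list deriv).

Definition kconcl (d : deriv) : nat * term :=
  match d with Node _ n L _ => (n, L) end.

Definition node_ok (nd : deriv) : Prop :=
  match nd with
  | Node r n L kids =>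
    lclosedb n L = true /\ rscopedb [] L = true /\
    match r with
    | RAx => kids = [] /\ exists m, n = S m /\ L = Var 0
    | RAssm c => kids = [] /\ L = Cst c
    | RLam => exists k L0, kids = [k] /\ kconcl k = (S n, L0) /\ L = Lam L0
    | RApp => exists k0 k1 L0 L1, kids = [k0; k1] /\ kconcl k0 = (n, L0) /\
                kconcl k1 = (n, L1) /\ L = App L0 L1
    | RDel => exists k m L0, kids = [k] /\ n = S m /\ kconcl k = (m, L0) /\
                L = lshift 0 L0
    | RFix cs => exists bs body,
        L = Letrec bs body /\ length cs = length bs /\ NoDup cs /\
        (forall c, In c cs -> hasc c body = false /\
                   forall b, In b bs -> hasc c b = false) /\
        length kids = S (length bs) /\
        (forall j b, nth_error bs j = Some b ->
           exists k, nth_error kids j = Some k /\ kconcl k = (n, rsubst cs 0 b)) /\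
        (exists k, nth_error kids (length bs) = Some k /\
                   kconcl k = (n, rsubst cs 0 body))
    end
  end.

Fixpoint node_at (d : deriv) (p : list nat) : option deriv :=
  match p with
  | [] => Some d
  | j :: p' =>
      match d with
      | Node _ _ _ kids =>
          match nth_error kids j with Some k => node_at k p' | None => None end
      end
  end.

Definition is_fix (d : deriv) : bool :=
  match d with Node (RFix _) _ _ _ => true | _ => false end.

(* the nearest strict ancestor (on the path p) that is a FIX instance using
   constant c: this is the instance discharging an assumption leaf at p *)
Fixpoint disch_aux (d : deriv) (p : list nat) (c : nat)
         (acc : option (list nat)) (here : list nat) : option (list nat) :=
  match p with
  | [] => acc
  | j :: p' =>
      match d with
      | Node r _ _ kids =>
          let acc' := match r with
                      | RFix cs => if existsb (Nat.eqb c) cs then Some here else acc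
                      | _ => acc
                      end in
          match nth_error kids j with
          | Some k => disch_aux k p' c acc' (here ++ [j])
          | None => None
          end
      end
  end.
Definition disch (d : deriv) (p : list nat) (c : nat) : option (list nat) :=
  disch_aux d p c None [].

Definition prefix_len (d : deriv) : nat := fst (kconcl d).

(* every assumption leaf is discharged (with matching prefix), and side
   condition (1) holds on the thread from the leaf down to the premise of the
   discharging instance *)
Definition assumptions_ok (d : deriv) : Prop :=
  forall p c n L kids, node_at d p = Some (Node (RAssm c) n L kids) ->
    exists q cs nq Lq kq,
      disch d p c = Some q /\
      node_at d q = Some (Node (RFix cs) nq Lq kq) /\
      nq = n /\
      (forall k, length q < k <= length p ->
         exists nd, node_at d (firstn k p) = Some nd /\ n <= prefix_len nd).

Definition amove (d : deriv) (p q : list nat) : Prop :=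
  match node_at d p with
  | Some (Node r _ _ _) =>
      match r with
      | RLam | RDel => q = p ++ [0]
      | RApp => q = p ++ [0] \/ q = p ++ [1]
      | RFix cs => q = p ++ [length cs]
      | RAssm c => exists r' cs i n L kids,
          disch d p c = Some r' /\ node_at d r' = Some (Node (RFix cs) n L kids) /\
          nth_error cs i = Some c /\ q = r' ++ [i]
      | RAx => False
      end
  | None => False
  end.

Definition unguarded_move (d : deriv) (p q : list nat) : Prop :=
  amove d p q /\
  match node_at d p with
  | Some (Node RLam _ _ _) | Some (Node RApp _ _ _) => False
  | _ => True
  end.

(* every cycle of every access path starting at position b contains an
   instance of (lambda) or (@) *)
Definition guarded_from (d : deriv) (b : list nat) : Prop :=
  forall p, clos_refl_trans (list nat) (amove d) b p ->
            ~ clos_trans (list nat) (unguarded_move d) p p.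

Definition bottommost_fix (d : deriv) (b : list nat) : Prop :=
  (exists nd, node_at d b = Some nd /\ is_fix nd = true) /\
  forall k, k < length b ->
    exists nd, node_at d (firstn k b) = Some nd /\ is_fix nd = false.

Definition deriv_ok (d : deriv) : Prop :=
  (forall p nd, node_at d p = Some nd -> node_ok nd) /\
  assumptions_ok d /\
  (forall b, bottommost_fix d b -> guarded_from d b).

Definition derivable (n : nat) (L : term) : Prop :=
  exists d : deriv, kconcl d = (n, L) /\ deriv_ok d.

(* Main.v *)
Require Import Defs.
From Stdlib Require Import List Arith Relations.
From Stdlib Require Import Bool Lia Wellfounded Classical ClassicalEpsilon.
Import ListNotations.

(** Both sides are compared with a compositional semantics: a term denotes the
    set of depths down to which its unfolding is productive, an abstraction or
    application adding one level and a letrec denoting a least fixed point.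

    Every unfolding step preserves this denotation, and a prefix of the limit
    witnesses productivity, so a term expressing an infinite term is productive
    at all depths.  Conversely a productive closed term head-normalises by a
    reducibility argument (head termination is a prefixed point), and
    normalising level by level gives a strongly convergent sequence.

    In a derivation, the depths up to which access paths stay guarded satisfy the
    same fixed-point equations, so the root term is productive at all depths iff
    the derivation is guarded on access path cycles.  Finally every closed term
    has a derivation satisfying all other side conditions: use fresh constants
    at each letrec, and apply (del+) only directly below axioms and
    assumptions. *)

(** * Productivity semantics *)

(** A least fixed point can describe an infinite unfolding because depth is finite. The equation
    [f = f] returns to the same depth and its least solution is empty; [f = Lam f] spends one level
    per round, so every depth is reached by induction. Guards on a cycle are thus what makes the
    recursion well founded. Quantifying over all prefixed points, with no closure in the depth
    demanded of them, turns each use of leastness into an instantiation: a predicate of interest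
    (head termination, liveness of access paths) is substituted for [X], and only the prefixed
    condition has to be checked. Nested and merged letrecs are compared in the same way, by
    splitting or gluing predicates. On the side of derivations, discharged constants replace
    recursion variables, so an assignment [K] of predicates to positions replaces the environment.
    For a derivation that meets the local conditions and discharges its assumptions, guardedness
    then depends on the root term alone, and any such derivation serves to pass from (i) to (ii). *)

Lemma term_nested_ind (Q : term -> Prop) :
  (forall i, Q (Var i)) ->
  (forall t, Q t -> Q (Lam t)) ->
  (forall t u, Q t -> Q u -> Q (App t u)) ->
  (forall k i, Q (RVar k i)) ->
  (forall bs b, (forall b', In b' bs -> Q b') -> Q b -> Q (Letrec bs b)) ->
  (forall c, Q (Cst c)) ->
  forall t, Q t.
Proof.
  intros HV HL HA HR HT HC.
  fix IH 1. intros [i|t|t u|k i|bs b|c];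
    [apply HV | apply HL, IH | apply HA; apply IH | apply HR | | apply HC].
  apply HT; [|apply IH].
  induction bs as [|b0 bs IHbs]; simpl; intros b' Hb; [tauto|].
  destruct Hb as [<-|Hb]; [apply IH | apply IHbs, Hb].
Qed.

Definition obs := nat -> Prop.

Definition scons (X : nat -> obs) (rho : nat -> nat -> obs) : nat -> nat -> obs :=
  fun k => match k with 0 => X | S k' => rho k' end.

(* [productive kap t rho d]: unfolding [t] produces constructors down to depth [d]
   on every branch.  A letrec denotes the least fixed point of its bindings,
   encoded as the intersection of all prefixed points [X]. *)
Fixpoint productive (kap : nat -> obs) (t : term) (rho : nat -> nat -> obs) (d : nat)
  {struct t} : Prop :=
  match t with
  | Var _ => True
  | Lam u => match d with 0 => True | S e => productive kap u rho e end
  | App u v =>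
      match d with 0 => True | S e => productive kap u rho e /\ productive kap v rho e end
  | RVar k i => rho k i d
  | Letrec bs b =>
      forall X : nat -> obs,
        (forall i e, nth i (map (fun b' => productive kap b' (scons X rho)) bs)
                         (fun _ => False) e -> X i e) ->
        productive kap b (scons X rho) d
  | Cst c => kap c d
  end.

Definition prefixed kap bs rho (X : nat -> obs) : Prop :=
  forall i b e, nth_error bs i = Some b -> productive kap b (scons X rho) e -> X i e.

(** The default [fun _ => False] imposes nothing at indices without a binding, so the condition on
    [X] in the definition is [prefixed]; the form with [map] and [nth] keeps the recursive calls
    structural. *)
Lemma productive_letrec kap bs b rho d :
  productive kap (Letrec bs b) rho d <->
  forall X, prefixed kap bs rho X -> productive kap b (scons X rho) d.
Proof.
  simpl. split; intros H X HX; apply H; unfold prefixed in *.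
  - intros i e Hi. destruct (nth_error bs i) as [b0|] eqn:E.
    + apply (HX i b0 e E).
      rewrite (nth_indep _ _ (productive kap (Var 0) (scons X rho))) in Hi
        by (rewrite length_map; apply nth_error_Some; congruence).
      rewrite (map_nth (fun b' => productive kap b' (scons X rho))) in Hi.
      now rewrite (nth_error_nth _ _ _ E) in Hi.
    + apply nth_error_None in E. rewrite nth_overflow in Hi; [tauto|].
      now rewrite length_map.
  - intros i b0 e Hi Hb. apply HX.
    rewrite (nth_indep _ _ (productive kap (Var 0) (scons X rho)))
      by (rewrite length_map; apply nth_error_Some; congruence).
    rewrite (map_nth (fun b' => productive kap b' (scons X rho))).
    now rewrite (nth_error_nth _ _ _ Hi).
Qed.

Lemma rocc_binding bs b lvl i b' :
  In b' bs -> rocc (S lvl) i b' = true -> rocc lvl i (Letrec bs b) = true.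
Proof.
  intros Hin H. simpl. apply orb_true_iff; left. apply existsb_exists; eauto.
Qed.

Lemma rocc_body bs b lvl i :
  rocc (S lvl) i b = true -> rocc lvl i (Letrec bs b) = true.
Proof. intros H. simpl. rewrite H. apply orb_true_r. Qed.

(** All predicates occur positively: an [X] prefixed for the larger assignments is prefixed for the
    smaller ones. The hypotheses concern only what occurs in [t], so the lemma also changes
    environments outside the support of [t]. *)
Lemma productive_mono t : forall kap kap' rho rho' d,
  (forall c e, hasc c t = true -> kap c e -> kap' c e) ->
  (forall k i e, rocc k i t = true -> rho k i e -> rho' k i e) ->
  productive kap t rho d -> productive kap' t rho' d.
Proof.
  induction t as [i|t IH|t u IHt IHu|k i|bs b IHbs IHb|c] using term_nested_ind;
    intros kap kap' rho rho' d Hk Hr; simpl in Hk, Hr.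
  - auto.
  - destruct d; simpl; auto. apply IH; auto.
  - destruct d; simpl; auto. intros [H1 H2]. split.
    + apply (IHt kap kap' rho rho'); auto; intros; [apply Hk|apply Hr]; auto;
        apply orb_true_iff; auto.
    + apply (IHu kap kap' rho rho'); auto; intros; [apply Hk|apply Hr]; auto;
        apply orb_true_iff; auto.
  - simpl. apply Hr. now rewrite !Nat.eqb_refl.
  - rewrite !productive_letrec. intros H X HX.
    apply (IHb kap kap' (scons X rho)).
    + intros c e Hc. apply Hk. rewrite Hc. apply orb_true_r.
    + intros [|k] i e Hc; simpl; auto. apply Hr. rewrite Hc. apply orb_true_r.
    + apply H. intros i b0 e Hi Hb. apply (HX i b0 e Hi).
      assert (Hin : In b0 bs) by (eapply nth_error_In; eauto).
      apply (IHbs b0 Hin kap kap' (scons X rho)); auto.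
      * intros c e' Hc. apply Hk. apply orb_true_iff; left.
        apply existsb_exists; eauto.
      * intros [|k] i' e' Hc; simpl; auto. apply Hr.
        apply orb_true_iff; left. apply existsb_exists; eauto.
  - simpl. apply Hk. now rewrite Nat.eqb_refl.
Qed.

Lemma productive_lshift t : forall kap c rho d,
  productive kap (lshift c t) rho d <-> productive kap t rho d.
Proof.
  induction t as [i|t IH|t u IHt IHu|k i|bs b IHbs IHb|x] using term_nested_ind;
    intros kap c rho d; try (simpl; tauto).
  - simpl. destruct d; [tauto|apply IH].
  - simpl. destruct d; [tauto|]. now rewrite IHt, IHu.
  - change (lshift c (Letrec bs b)) with (Letrec (map (lshift c) bs) (lshift c b)).
    rewrite !productive_letrec. split; intros H X HX; apply (IHb kap c), H; intros i b0 e Hi Hb.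
    + rewrite nth_error_map in Hi.
      destruct (nth_error bs i) as [b1|] eqn:E; simpl in Hi; inversion Hi; subst.
      apply (HX i b1 e E). apply IHbs in Hb; [auto|eapply nth_error_In; eauto].
    + apply (HX i (lshift c b0) e).
      * rewrite nth_error_map, Hi; auto.
      * apply IHbs; [eapply nth_error_In; eauto|auto].
Qed.

(** * Operations acting on recursion variables only *)

(** Common pattern of [rrename], [runshift], [merge_inner] and [rsubst]. The last two fields say
    that crossing a letrec fixes its own variables and shifts the others together with their images,
    which are variables or constants. *)
Record rec_op (op : nat -> term -> term) : Prop := {
  op_var l i : op l (Var i) = Var i;
  op_lam l t : op l (Lam t) = Lam (op l t);
  op_app l t u : op l (App t u) = App (op l t) (op l u);
  op_letrec l bs b : op l (Letrec bs b) = Letrec (map (op (S l)) bs) (op (S l) b);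
  op_cst l c : op l (Cst c) = Cst c;
  op_rvar0 l i : op (S l) (RVar 0 i) = RVar 0 i;
  op_rvarS l k i :
    (exists k' i', op l (RVar k i) = RVar k' i' /\
                   op (S l) (RVar (S k) i) = RVar (S k') i') \/
    (exists c, op l (RVar k i) = Cst c /\ op (S l) (RVar (S k) i) = Cst c)
}.

(** A substitution lemma: the operation moves into the environment. The two variable fields of
    [rec_op] make this commute with [scons] under a letrec. *)
Lemma productive_rec_op op (O : rec_op op) kap t : forall l rho d,
  productive kap (op l t) rho d <->
  productive kap t (fun k i => productive kap (op l (RVar k i)) rho) d.
Proof.
  induction t as [i|t IH|t u IHt IHu|k i|bs b IHbs IHb|x] using term_nested_ind;
    intros l rho d.
  - now rewrite op_var.
  - rewrite op_lam by auto. simpl. destruct d; [tauto|apply IH].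
  - rewrite op_app by auto. simpl. destruct d; [tauto|]. now rewrite IHt, IHu.
  - reflexivity.
  - rewrite op_letrec by auto. rewrite !productive_letrec.
    assert (E : forall X t e,
      productive kap t (fun k i => productive kap (op (S l) (RVar k i)) (scons X rho)) e <->
      productive kap t (scons X (fun k i => productive kap (op l (RVar k i)) rho)) e).
    { intros X t e. split; apply productive_mono; auto; intros [|k] i e' _; simpl;
        try (rewrite op_rvar0 by auto; simpl; tauto);
        destruct (op_rvarS op O l k i) as [(k' & i' & -> & ->)|(c & -> & ->)]; simpl; auto. }
    split; intros H X HX.
    + apply E, IHb, H. intros i b0 e Hi Hb. rewrite nth_error_map in Hi.
      destruct (nth_error bs i) as [b1|] eqn:Eb; simpl in Hi; inversion Hi; subst.
      apply (HX i b1 e Eb), E, IHbs; auto. eapply nth_error_In; eauto.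
    + apply IHb, E, H. intros i b0 e Hi Hb.
      apply (HX i (op (S l) b0) e).
      * rewrite nth_error_map, Hi; auto.
      * apply IHbs, E; auto. eapply nth_error_In; eauto.
  - now rewrite op_cst.
Qed.

Ltac rvar_cases :=
  repeat match goal with
  | |- context [?a =? ?b] => destruct (Nat.eqb_spec a b)
  | |- context [?a <? ?b] => destruct (Nat.ltb_spec a b)
  | |- context [nth_error ?l ?i] => destruct (nth_error l i)
  end; try lia; simpl; eauto 6;
  try (left; do 2 eexists; split; [reflexivity|f_equal; lia]).

Lemma rec_op_rrename f : rec_op (fun l => rrename l f).
Proof. constructor; intros; try reflexivity. simpl. rvar_cases. Qed.

Lemma rec_op_runshift : rec_op runshift.
Proof. constructor; intros; try reflexivity. cbn [runshift]. rvar_cases. Qed.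

Lemma rec_op_merge_inner n : rec_op (merge_inner n).
Proof. constructor; intros; try reflexivity. cbn [merge_inner]. rvar_cases. Qed.

Lemma rec_op_rsubst cs : rec_op (rsubst cs).
Proof. constructor; intros; try reflexivity. cbn [rsubst]. rvar_cases. Qed.

(** Turns [rscoped_rec_op] into weakening of the scope list. *)
Lemma rec_op_id : rec_op (fun _ t => t).
Proof. constructor; intros; try rewrite map_id; eauto 6. Qed.

Definition in_scope (ks : list nat) (k i : nat) : Prop :=
  exists m, nth_error ks k = Some m /\ i < m.

Lemma rscoped_letrec ks bs b :
  rscopedb ks (Letrec bs b) = true <->
  (forall b', In b' bs -> rscopedb (length bs :: ks) b' = true) /\
  rscopedb (length bs :: ks) b = true.
Proof. simpl. now rewrite andb_true_iff, forallb_forall. Qed.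

Lemma rscoped_rvar ks k i : rscopedb ks (RVar k i) = true <-> in_scope ks k i.
Proof.
  simpl. unfold in_scope. destruct (nth_error ks k) as [m|].
  - rewrite Nat.ltb_lt. split; [eauto|]. intros (m' & E & ?). now inversion E.
  - split; [discriminate|]. intros (m' & E & ?). discriminate.
Qed.

Lemma rscoped_rocc t : forall ks k i,
  rscopedb ks t = true -> rocc k i t = true -> in_scope ks k i.
Proof.
  induction t as [i|t IH|t u IHt IHu|k i|bs b IHbs IHb|x] using term_nested_ind;
    intros ks k' i' Hs Ho; try discriminate.
  - apply (IH ks); auto.
  - simpl in *. apply andb_true_iff in Hs as [H1 H2].
    apply orb_true_iff in Ho as [?|?]; auto.
  - apply rscoped_rvar in Hs. simpl in Ho.
    apply andb_true_iff in Ho as [H1 H2].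
    apply Nat.eqb_eq in H1, H2. now subst.
  - apply rscoped_letrec in Hs as [H1 H2]. simpl in Ho.
    apply orb_true_iff in Ho as [H|H].
    + apply existsb_exists in H as (b' & Hin & H).
      apply (IHbs b' Hin _ (S k') i' (H1 _ Hin) H).
    + apply (IHb _ (S k') i' H2 H).
Qed.

Lemma rscoped_rec_op op (O : rec_op op) t : forall l ks ks',
  rscopedb ks t = true ->
  (forall k i, rocc k i t = true -> in_scope ks k i ->
     rscopedb ks' (op l (RVar k i)) = true) ->
  rscopedb ks' (op l t) = true.
Proof.
  induction t as [i|t IH|t u IHt IHu|k i|bs b IHbs IHb|x] using term_nested_ind;
    intros l ks ks' Hs Ho.
  - now rewrite op_var.
  - rewrite op_lam by auto. apply (IH l ks); auto.
  - rewrite op_app by auto. simpl in *. apply andb_true_iff in Hs as [H1 H2].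
    apply andb_true_iff. split; [apply (IHt l ks)|apply (IHu l ks)]; auto;
      intros; apply Ho; auto; apply orb_true_iff; auto.
  - apply Ho; [simpl; now rewrite !Nat.eqb_refl | now apply rscoped_rvar].
  - rewrite op_letrec by auto. apply rscoped_letrec in Hs as [H1 H2].
    rewrite rscoped_letrec, length_map.
    assert (E : forall b', (forall k i, rocc (S k) i b' = true ->
                              rocc k i (Letrec bs b) = true) ->
      forall k i, rocc k i b' = true -> in_scope (length bs :: ks) k i ->
      rscopedb (length bs :: ks') (op (S l) (RVar k i)) = true).
    { intros b' Hb [|k] i Hoc Hi.
      - rewrite op_rvar0 by auto. apply rscoped_rvar.
        destruct Hi as (m & Hm & Hlt). exists m. split; auto.
      - specialize (Ho k i (Hb k i Hoc) Hi).
        destruct (op_rvarS op O l k i) as [(k' & i' & E & E')|(c & E & E')];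
          rewrite E'; auto. rewrite E in Ho. exact Ho. }
    split.
    + intros b' Hin. apply in_map_iff in Hin as (b0 & <- & Hin).
      apply (IHbs b0 Hin (S l) (length bs :: ks)); auto. apply E.
      intros; eapply rocc_binding; eauto.
    + apply (IHb (S l) (length bs :: ks)); auto. apply E.
      intros; apply rocc_body; auto.
  - now rewrite op_cst.
Qed.

Lemma rscoped_lshift t : forall c ks, rscopedb ks (lshift c t) = rscopedb ks t.
Proof.
  induction t as [i|t IH|t u IHt IHu|k i|bs b IHbs IHb|x] using term_nested_ind;
    intros c ks; simpl; auto.
  - now rewrite IHt, IHu.
  - rewrite length_map, IHb. f_equal.
    assert (E : forall ks', forallb (rscopedb ks') (map (lshift c) bs) =
                            forallb (rscopedb ks') bs); [|apply E].
    intros ks'. clear IHb. induction bs as [|b0 bs IH]; simpl; auto.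
    rewrite IHbs by (simpl; auto). f_equal. apply IH.
    intros; apply IHbs; simpl; auto.
Qed.

(** * Invariance of productivity under unfolding steps *)

Definition productive_equiv (t t' : term) : Prop :=
  forall kap rho d, productive kap t rho d <-> productive kap t' rho d.

Lemma productive_letrec_map kap (f : term -> term) bs b b' rho d :
  (forall b0, In b0 bs -> productive_equiv b0 (f b0)) -> productive_equiv b b' ->
  productive kap (Letrec bs b) rho d <-> productive kap (Letrec (map f bs) b') rho d.
Proof.
  intros Hbs Hb. rewrite !productive_letrec.
  split; intros H X HX; apply Hb, H; intros i b0 e Hi Hp.
  - apply (HX i (f b0) e); [now rewrite nth_error_map, Hi|].
    apply (Hbs b0 (nth_error_In _ _ Hi)), Hp.
  - rewrite nth_error_map in Hi.
    destruct (nth_error bs i) as [b1|] eqn:E; simpl in Hi; inversion Hi; subst.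
    apply (HX i b1 e E), (Hbs b1 (nth_error_In _ _ E)), Hp.
Qed.

(** The Bekić principle: nested least fixed points amount to a simultaneous one. A family for the
    merged bindings splits into an outer and an inner family, and such a pair glues to one family.
    Scoping excludes outer references with index at least [length bs], which would read the inner
    family after gluing. *)
Lemma productive_nest ks bs bs' L :
  rscopedb ks (Letrec bs (Letrec bs' L)) = true ->
  productive_equiv (Letrec bs (Letrec bs' L))
    (Letrec (bs ++ map (merge_inner (length bs) 0) bs') (merge_inner (length bs) 0 L)).
Proof.
  intros Hs kap rho d. set (n := length bs).
  apply rscoped_letrec in Hs as [Hbs Hs]. apply rscoped_letrec in Hs as [Hbs' HL].
  fold n in Hbs, Hbs', HL.
  assert (M : forall Z t e, productive kap (merge_inner n 0 t) (scons Z rho) e <->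
    productive kap t (scons (fun i => Z (n + i)) (scons Z rho)) e).
  { intros Z t e. rewrite (productive_rec_op _ (rec_op_merge_inner n)).
    split; apply productive_mono; auto; intros [|[|k]] i e' _; simpl; auto. }
  rewrite !productive_letrec. split; intros H.
  (* [Z] itself serves as the outer family, since [prefixed] constrains it only at the first [n]
     indices. *)
  - intros Z HZ. apply M. specialize (H Z). rewrite productive_letrec in H. apply H.
    + intros i b e Hi Hb. apply (HZ i b e); auto.
      rewrite nth_error_app1; auto. apply nth_error_Some; congruence.
    + intros i b e Hi Hb. apply (HZ (n + i) (merge_inner n 0 b) e).
      * rewrite nth_error_app2 by (unfold n; lia).
        replace (n + i - length bs) with i by (unfold n; lia).
        now rewrite nth_error_map, Hi.
      * now apply M.
  - intros X HX. apply productive_letrec. intros Y HY.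
    set (Z := fun i => if i <? n then X i else Y (i - n)).
    assert (ZX : forall t e, rscopedb (n :: ks) t = true ->
      productive kap t (scons Z rho) e -> productive kap t (scons X rho) e).
    { intros t e Ht. apply productive_mono; auto. intros [|k] i e' Ho; simpl; auto.
      destruct (rscoped_rocc _ _ _ _ Ht Ho) as (m & Em & Hlt).
      simpl in Em. inversion Em; subst m. unfold Z.
      destruct (Nat.ltb_spec i n); [auto|lia]. }
    assert (ZYX : forall t e, rscopedb (length bs' :: n :: ks) t = true ->
      productive kap (merge_inner n 0 t) (scons Z rho) e ->
      productive kap t (scons Y (scons X rho)) e).
    { intros t e Ht H1. apply M in H1. revert H1.
      apply productive_mono; auto. intros [|[|k]] i e' Ho; simpl; auto; unfold Z.
      - destruct (Nat.ltb_spec (n + i) n); [lia|].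
        now replace (n + i - n) with i by lia.
      - destruct (rscoped_rocc _ _ _ _ Ht Ho) as (m & Em & Hlt).
        simpl in Em. inversion Em; subst m.
        destruct (Nat.ltb_spec i n); [auto|lia]. }
    apply ZYX; auto. apply H. intros i b e Hi Hb.
    destruct (Nat.ltb_spec i n) as [Hlt|Hge].
    + rewrite nth_error_app1 in Hi by auto. unfold Z.
      rewrite (proj2 (Nat.ltb_lt i n)) by auto.
      apply (HX i b e Hi), ZX; auto. apply Hbs. eapply nth_error_In; eauto.
    + rewrite nth_error_app2 in Hi by auto. rewrite nth_error_map in Hi.
      destruct (nth_error bs' (i - length bs)) as [b1|] eqn:E; simpl in Hi;
        inversion Hi; subst.
      unfold Z. rewrite (proj2 (Nat.ltb_ge i n)) by auto.
      apply (HY (i - n) b1 e E), ZYX; auto. apply Hbs'. eapply nth_error_In; eauto.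
Qed.

Lemma gc_keep_nth keep : forall bs i b,
  length keep = length bs ->
  nth_error bs i = Some b -> nth i keep true = true ->
  nth_error (gc_keep keep bs) (gc_map keep i) = Some b.
Proof.
  unfold gc_keep, gc_map.
  induction keep as [|k keep IH]; intros [|b0 bs] i b Hl Hi Hk; simpl in *;
    try discriminate; [destruct i; discriminate|].
  destruct i as [|i]; simpl in *.
  - subst k. simpl. auto.
  - destruct k; simpl; apply IH; auto.
Qed.

Lemma gc_keep_inv keep : forall bs j b,
  length keep = length bs ->
  nth_error (gc_keep keep bs) j = Some b ->
  exists i, nth_error bs i = Some b /\ nth i keep true = true /\ gc_map keep i = j.
Proof.
  unfold gc_keep, gc_map.
  induction keep as [|k keep IH]; intros [|b0 bs] j b Hl Hj; simpl in *;
    try discriminate; try (destruct j; discriminate).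
  destruct k; simpl in Hj.
  - destruct j as [|j]; simpl in Hj.
    + exists 0. inversion Hj; auto.
    + destruct (IH bs j b) as (i & H1 & H2 & H3); auto.
      exists (S i). simpl. auto.
  - destruct (IH bs j b) as (i & H1 & H2 & H3); auto.
    exists (S i). simpl. auto.
Qed.

Lemma gc_map_inj keep : forall i j,
  i < length keep -> j < length keep ->
  nth i keep true = true -> nth j keep true = true ->
  gc_map keep i = gc_map keep j -> i = j.
Proof.
  unfold gc_map.
  induction keep as [|k keep IH]; simpl; intros i j Hi Hj Hki Hkj E; [lia|].
  destruct i as [|i], j as [|j]; simpl in *; auto; subst; simpl in *; try discriminate.
  f_equal. apply IH; auto; try lia. destruct k; simpl in E; lia.
Qed.

Lemma productive_gc ks bs L keep :
  rscopedb ks (Letrec bs L) = true ->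
  length keep = length bs ->
  (forall i, nth i keep true = false ->
     rocc 0 i L = false /\
     forall j b, nth_error bs j = Some b -> nth j keep true = true ->
                 rocc 0 i b = false) ->
  productive_equiv (Letrec bs L)
    (Letrec (map (rrename 0 (gc_map keep)) (gc_keep keep bs))
            (rrename 0 (gc_map keep) L)).
Proof.
  intros Hs Hlen Hgc kap rho d. set (f := gc_map keep).
  apply rscoped_letrec in Hs as [Hbs HL].
  assert (M : forall Z t e, productive kap (rrename 0 f t) (scons Z rho) e <->
    productive kap t (scons (fun i => Z (f i)) rho) e).
  { intros Z t e. rewrite (productive_rec_op _ (rec_op_rrename f)).
    split; apply productive_mono; auto; intros [|k] i e' _; simpl; auto. }
  rewrite !productive_letrec. split; intros H.
  - intros Z HZ. apply M.
    (* Removed bindings get the everywhere true predicate, which meets the prefixed condition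
       trivially and is never read by what survives. *)
    set (X := fun i e => nth i keep true = true -> Z (f i) e).
    assert (XZ : forall t e,
      (forall i, nth i keep true = false -> rocc 0 i t = false) ->
      productive kap t (scons X rho) e -> productive kap t (scons (fun i => Z (f i)) rho) e).
    { intros t e Ht. apply productive_mono; auto. intros [|k] i e' Ho; simpl; auto.
      unfold X. intros HX. apply HX. destruct (nth i keep true) eqn:E; auto.
      rewrite Ht in Ho; auto. }
    apply XZ; [intros; now apply Hgc|]. apply H.
    intros i b e Hi Hb Hk.
    apply (HZ (f i) (rrename 0 f b) e).
    + rewrite nth_error_map. unfold f.
      now rewrite (gc_keep_nth keep bs i b).
    + apply M, XZ; auto. intros i' Hi'. apply (proj2 (Hgc i' Hi') i); auto.
  - intros X HX.
    (* Image of [X] under the renumbering; [gc_map_inj] recovers the index of a surviving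
       binding. *)
    set (Z := fun j e => exists i, i < length keep /\ nth i keep true = true /\
                         f i = j /\ X i e).
    assert (ZX : forall t e, rscopedb (length bs :: ks) t = true ->
      (forall i, nth i keep true = false -> rocc 0 i t = false) ->
      productive kap (rrename 0 f t) (scons Z rho) e -> productive kap t (scons X rho) e).
    { intros t e Hs Ht H1. apply M in H1. revert H1.
      apply productive_mono; auto. intros [|k] i e' Ho; simpl; auto.
      intros (i' & Hi' & Hk' & Hf & HX').
      destruct (rscoped_rocc _ _ _ _ Hs Ho) as (m & Em & Hlt).
      simpl in Em. inversion Em; subst m.
      replace i with i'; auto. apply (gc_map_inj keep); auto; [lia|].
      destruct (nth i keep true) eqn:E; auto. rewrite Ht in Ho; auto. }
    apply ZX; auto; [intros; now apply Hgc|]. apply H.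
    intros j b e Hj Hb. rewrite nth_error_map in Hj.
    destruct (nth_error (gc_keep keep bs) j) as [b1|] eqn:E; simpl in Hj;
      inversion Hj; subst.
    apply gc_keep_inv in E as (i & Hi & Hk & <-); auto.
    exists i. assert (i < length bs) by (apply nth_error_Some; congruence).
    repeat split; auto; [lia|].
    apply (HX i b1 e Hi), ZX; auto.
    + apply Hbs. eapply nth_error_In; eauto.
    + intros i' Hi'. apply (proj2 (Hgc i' Hi') i); auto.
Qed.

Lemma productive_nil ks L :
  rscopedb ks (Letrec [] L) = true -> productive_equiv (Letrec [] L) (runshift 0 L).
Proof.
  intros Hs kap rho d. apply rscoped_letrec in Hs as [_ Hs].
  assert (D : forall k i, rocc k i L = true -> exists k', k = S k').
  { intros [|k] i Ho; eauto.
    destruct (rscoped_rocc _ _ _ _ Hs Ho) as (m & Em & Hlt).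
    simpl in Em. inversion Em; subst m. lia. }
  rewrite productive_letrec, (productive_rec_op _ rec_op_runshift). split.
  (* Without bindings every [X] is prefixed, and scoping leaves no variable of level 0 in [L] that
     could read it. *)
  - intros H. assert (H1 := H (fun _ _ => True)). revert H1.
    intros H1. eapply productive_mono; [| |apply H1].
    + auto.
    + intros k i e Ho. destruct (D k i Ho) as (k' & ->). simpl.
      now rewrite Nat.sub_0_r.
    + intros [|?]; discriminate.
  - intros H X _. revert H. apply productive_mono; auto.
    intros k i e Ho. destruct (D k i Ho) as (k' & ->). simpl.
    now rewrite Nat.sub_0_r.
Qed.

Lemma productive_unfold bs i Li :
  nth_error bs i = Some Li ->
  productive_equiv (Letrec bs (RVar 0 i)) (Letrec bs Li).
Proof.
  intros Hi kap rho d. rewrite !productive_letrec. split; intros H X HX.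
  (* One application of the binding operator to [X] is again prefixed, by monotonicity, and yields
     the binding [Li] in place of [X i]. This is the Knaster-Tarski argument that a least prefixed
     point is a fixed point. *)
  - specialize (H (fun j e => exists b, nth_error bs j = Some b /\
                              productive kap b (scons X rho) e)).
    destruct H as (b & Hb & H); [|congruence].
    intros j b e Hj Hb. exists b. split; auto. revert Hb. apply productive_mono; auto.
    intros [|k] i' e' _; simpl; auto. intros (b' & Hb' & Hp). eapply HX; eauto.
  - simpl. eapply HX; eauto.
Qed.

Lemma root_step_productive t t' ks :
  root_step t t' -> rscopedb ks t = true -> productive_equiv t t'.
Proof.
  intros [bs L|bs L0 L1|bs i Li Hi|bs bs' L|bs L keep Hlen Hin Hgc|L] Hs.
  - intros kap rho d.
    assert (E : forall d, productive kap (Letrec bs L) rho d <->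
                productive kap (Letrec (map (lshift 0) bs) L) rho d).
    { intros d0. apply productive_letrec_map.
      - intros b0 _ ? ? ?. symmetry. apply productive_lshift.
      - intros ? ? ?. reflexivity. }
    simpl. destruct d; [tauto|]. apply E.
  - intros kap rho d. simpl. destruct d; [tauto|]. firstorder.
  - now apply productive_unfold.
  - eapply productive_nest; eauto.
  - eapply productive_gc; eauto.
  - eapply productive_nil; eauto.
Qed.

Lemma root_step_scoped t t' ks :
  root_step t t' -> rscopedb ks t = true -> rscopedb ks t' = true.
Proof.
  intros [bs L|bs L0 L1|bs i Li Hi|bs bs' L|bs L keep Hlen Hin Hgc|L] Hs;
    apply rscoped_letrec in Hs as [Hbs HL].
  - change (rscopedb ks (Letrec (map (lshift 0) bs) L) = true).
    rewrite rscoped_letrec, length_map. split; auto.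
    intros b' Hb. apply in_map_iff in Hb as (b & <- & Hb).
    rewrite rscoped_lshift; auto.
  - simpl in HL. apply andb_true_iff in HL as [H1 H2].
    change (rscopedb ks (Letrec bs L0) && rscopedb ks (Letrec bs L1) = true).
    rewrite andb_true_iff, !rscoped_letrec; auto.
  - apply rscoped_letrec; split; auto. apply Hbs. eapply nth_error_In; eauto.
  - apply rscoped_letrec in HL as [Hbs' HL].
    rewrite rscoped_letrec, length_app, length_map.
    assert (E : forall t, rscopedb (length bs' :: length bs :: ks) t = true ->
      rscopedb (length bs + length bs' :: ks) (merge_inner (length bs) 0 t) = true).
    { intros s Ht.
      apply (rscoped_rec_op _ (rec_op_merge_inner _) s 0 _ _ Ht).
      intros [|[|k]] i _ (m & Em & Hlt); simpl in Em |- *;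
        [inversion Em; subst; apply Nat.ltb_lt; lia ..|].
      rewrite Em. now apply Nat.ltb_lt. }
    split; auto. intros b' Hb. apply in_app_or in Hb as [Hb|Hb].
    (* Only the innermost binding count grows, so the identity operation transports the scoping of
       the old bindings. *)
    + apply (rscoped_rec_op _ rec_op_id b' 0 _ _ (Hbs _ Hb)).
      intros k i _ (m & Em & Hlt). apply rscoped_rvar.
      destruct k; [|now exists m]. simpl in Em. inversion Em; subst.
      exists (length bs + length bs'). split; auto; lia.
    + apply in_map_iff in Hb as (b & <- & Hb); auto.
  - rewrite rscoped_letrec, length_map.
    assert (E : forall t, rscopedb (length bs :: ks) t = true ->
      (forall i, nth i keep true = false -> rocc 0 i t = false) ->
      rscopedb (length (gc_keep keep bs) :: ks) (rrename 0 (gc_map keep) t) = true).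
    { intros s Ht Ho.
      apply (rscoped_rec_op _ (rec_op_rrename (gc_map keep)) s 0 _ _ Ht).
      intros [|k] i Hoc (m & Em & Hlt); [|apply rscoped_rvar; now exists m].
      simpl in Em. inversion Em; subst. simpl. apply Nat.ltb_lt.
      apply nth_error_Some.
      destruct (nth_error bs i) as [b|] eqn:Eb; [|apply nth_error_None in Eb; lia].
      rewrite (gc_keep_nth keep bs i b); auto; [discriminate|].
      destruct (nth i keep true) eqn:E; auto. rewrite Ho in Hoc; auto. }
    split; [|apply E; auto; intros; now apply Hgc].
    intros b' Hb. apply in_map_iff in Hb as (b & <- & Hb).
    apply In_nth_error in Hb as (j & Hj).
    apply gc_keep_inv in Hj as (i & Hi & Hk & _); auto.
    apply E; [apply Hbs; eapply nth_error_In; eauto|].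
    intros i' Hi'. apply (proj2 (Hgc i' Hi') i); auto.
  - apply (rscoped_rec_op _ rec_op_runshift L 0 _ _ HL).
    intros [|k] i _ (m & Em & Hlt); simpl in Em; [inversion Em; subst; lia|].
    simpl. rewrite Nat.sub_0_r, Em. now apply Nat.ltb_lt.
Qed.

Lemma prefixed_replace kap bs1 b b' bs2 rho X :
  productive_equiv b b' ->
  prefixed kap (bs1 ++ b :: bs2) rho X -> prefixed kap (bs1 ++ b' :: bs2) rho X.
Proof.
  intros Hb HX i c e Hi Hc.
  destruct (Nat.eq_dec i (length bs1)) as [->|Hne].
  - rewrite nth_error_app2, Nat.sub_diag in Hi by lia.
    simpl in Hi; inversion Hi; subst.
    apply (HX (length bs1) b); [|now apply Hb].
    now rewrite nth_error_app2, Nat.sub_diag by lia.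
  - apply (HX i c); auto. rewrite <- Hi.
    destruct (Nat.lt_ge_cases i (length bs1)).
    + now rewrite !nth_error_app1 by lia.
    + rewrite !nth_error_app2 by lia.
      destruct (i - length bs1) eqn:?; [lia|reflexivity].
Qed.

(** Scoping is carried along because the root equivalences depend on it, in a scope list [ks] that
    changes under a letrec. *)
Lemma step_sound n t t' :
  step n t t' -> forall ks, rscopedb ks t = true ->
  rscopedb ks t' = true /\ productive_equiv t t'.
Proof.
  induction 1 as [t t' Hr|n t t' _ IH|n t t' v _ IH|n t t' v _ IH
                 |n bs1 b b' bs2 L _ IH|n bs L L' _ IH]; intros ks Hs.
  - split; [eapply root_step_scoped|eapply root_step_productive]; eauto.
  - destruct (IH ks Hs) as [H1 H2]. split; auto.
    intros kap rho [|d]; simpl; [tauto|apply H2].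
  - simpl in *. apply andb_true_iff in Hs as [H H']. destruct (IH ks H) as [H1 H2].
    split; [now apply andb_true_iff|].
    intros kap rho [|d]; simpl; [tauto|]. now rewrite (H2 kap rho d).
  - simpl in *. apply andb_true_iff in Hs as [H' H]. destruct (IH ks H) as [H1 H2].
    split; [now apply andb_true_iff|].
    intros kap rho [|d]; simpl; [tauto|]. now rewrite (H2 kap rho d).
  - apply rscoped_letrec in Hs as [Hbs HL].
    assert (E : length (bs1 ++ b :: bs2) = length (bs1 ++ b' :: bs2))
      by (rewrite !length_app; reflexivity).
    rewrite E in Hbs, HL.
    destruct (IH (length (bs1 ++ b' :: bs2) :: ks)) as [H1 H2].
    { apply Hbs, in_or_app. simpl; auto. }
    split.
    + apply rscoped_letrec. split; auto. intros c Hc.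
      apply in_app_or in Hc as [Hc|[<-|Hc]]; auto; apply Hbs, in_or_app; simpl; auto.
    + intros kap rho d. rewrite !productive_letrec.
      split; intros H X HX; apply H; revert HX; apply prefixed_replace; auto.
      intros ? ? ?. symmetry. apply H2.
  - apply rscoped_letrec in Hs as [Hbs HL].
    destruct (IH _ HL) as [H1 H2]. split; [now apply rscoped_letrec|].
    intros kap rho d. rewrite !productive_letrec.
    split; intros H X HX; apply H2, H, HX.
Qed.

Definition botk : nat -> obs := fun _ _ => False.
Definition botr : nat -> nat -> obs := fun _ _ _ => False.

(** Agreement at [S d] inspects the constructors at depths 0 to [d] and finds no letrec, recursion
    variable or constant among them; hence [kap] and [rho] are arbitrary. *)
Lemma agree_productive kap rho d : forall t M, agree (S d) t M -> productive kap t rho d.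
Proof.
  induction d as [|d IH]; intros [i|t|t u|k i|bs b|c] [j|M|M N] H;
    try exact I; try (simpl in H; contradiction).
  - apply (IH t M), H.
  - destruct H as [H1 H2]. split; [apply (IH t M H1)|apply (IH u N H2)].
Qed.

Lemma expresses_productive L M :
  rscopedb [] L = true -> expresses L M -> forall d, productive botk L botr d.
Proof.
  intros Hs [(t & Hred & Hag)|(t & dep & <- & Hst & _ & Hag)] d.
  - apply clos_rt_rt1n in Hred.
    induction Hred as [L|L L' t [n Hn] _ IH].
    + eapply agree_productive, Hag.
    + destruct (step_sound _ _ _ Hn _ Hs) as [H1 H2]. apply H2, IH; auto.
  (* Depth [d] is settled at a finite stage [N], and invariance carries productivity back to the
     start. *)
  - destruct (Hag (S d)) as [N HN].
    assert (H : forall i, rscopedb [] (t i) = true /\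
               (productive botk (t i) botr d -> productive botk (t 0) botr d)).
    { induction i as [|i [IH1 IH2]]; auto.
      destruct (step_sound _ _ _ (Hst i) _ IH1) as [H1 H2].
      split; auto. intros H. apply IH2, H2, H. }
    apply (H N). eapply agree_productive, HN. auto.
Qed.

(** * Productive terms express infinite terms *)

Definition whnf (t : term) : Prop :=
  match t with Var _ | Lam _ | App _ _ => True | _ => False end.

Definition halts (t : term) : Prop :=
  exists t', clos_refl_trans_1n term root_step t t' /\ whnf t'.

Lemma halts_step t t' : root_step t t' -> halts t' -> halts t.
Proof. intros Hs (u & H & Hu). exists u. split; auto. econstructor; eauto. Qed.

Lemma halts_whnf t : whnf t -> halts t.
Proof. exists t. split; auto. constructor. Qed.

(** A measure preserved by every [rec_op]: merged or substituted terms are not subterms, so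
    structural induction does not reach them. *)
Fixpoint tsize (t : term) : nat :=
  match t with
  | Var _ | RVar _ _ | Cst _ => 1
  | Lam u => S (tsize u)
  | App u v => S (tsize u + tsize v)
  | Letrec bs b => S (list_sum (map tsize bs) + tsize b)
  end.

Lemma tsize_binding b bs : In b bs -> tsize b <= list_sum (map tsize bs).
Proof.
  induction bs as [|b0 bs IH]; simpl; [tauto|]. intros [->|H]; [lia|].
  specialize (IH H). lia.
Qed.

Lemma tsize_rec_op op (O : rec_op op) t : forall l, tsize (op l t) = tsize t.
Proof.
  induction t as [i|t IH|t u IHt IHu|k i|bs b IHbs IHb|x] using term_nested_ind;
    intros l.
  - now rewrite op_var.
  - rewrite op_lam by auto. simpl. now rewrite IH.
  - rewrite op_app by auto. simpl. now rewrite IHt, IHu.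
  - destruct (op_rvarS op O l k i) as [(? & ? & -> & _)|(? & -> & _)]; reflexivity.
  - rewrite op_letrec by auto. simpl. rewrite IHb, map_map. do 3 f_equal.
    apply map_ext_in. intros; auto.
  - now rewrite op_cst.
Qed.

Lemma rrename_id f t : forall l,
  (forall i, rocc l i t = true -> f i = i) -> rrename l f t = t.
Proof.
  induction t as [i|t IH|t u IHt IHu|k i|bs b IHbs IHb|x] using term_nested_ind;
    intros l H; simpl in *; auto.
  - now rewrite IH.
  - rewrite IHt, IHu; auto; intros; apply H, orb_true_iff; auto.
  - destruct (Nat.eqb_spec k l); auto. rewrite H; auto. apply Nat.eqb_refl.
  - rewrite IHb.
    + f_equal. rewrite <- (map_id bs) at 2. apply map_ext_in.
      intros b' Hin. apply IHbs; auto. intros i Hi. apply H, orb_true_iff.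
      left. apply existsb_exists; eauto.
    + intros i Hi. apply H. rewrite Hi. apply orb_true_r.
Qed.

Lemma nth_repeat_app n m i :
  nth i (repeat true n ++ repeat false m) true = false -> n <= i.
Proof.
  intros H. destruct (Nat.lt_ge_cases i n) as [Hlt|]; auto.
  rewrite app_nth1 in H by (now rewrite repeat_length).
  rewrite nth_repeat in H. discriminate.
Qed.

Lemma gc_map_repeat_app n m i :
  i < n -> gc_map (repeat true n ++ repeat false m) i = i.
Proof.
  unfold gc_map. revert i. induction n as [|n IH]; intros [|i] H; simpl; try lia.
  rewrite IH; lia.
Qed.

Lemma gc_keep_repeat_app B C :
  gc_keep (repeat true (length B) ++ repeat false (length C)) (B ++ C) = B.
Proof.
  unfold gc_keep. induction B as [|b B IH]; simpl; [|now rewrite IH].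
  induction C; simpl; auto.
Qed.

(** Lets a reference to an outer binding discard the inner bindings merged behind it. [C] is
    nonempty because [rs_gc] must remove something. *)
Lemma gc_suffix_step B C L :
  C <> [] ->
  (forall b, In b B -> rscopedb [length B] b = true) ->
  rscopedb [length B] L = true ->
  root_step (Letrec (B ++ C) L) (Letrec B L).
Proof.
  intros HC HB HL.
  assert (Hs : forall t i, rscopedb [length B] t = true -> rocc 0 i t = true ->
                           i < length B).
  { intros t i Ht Ho. destruct (rscoped_rocc _ _ _ _ Ht Ho) as (m & E & Hlt).
    simpl in E. inversion E; now subst m. }
  set (keep := repeat true (length B) ++ repeat false (length C)).
  assert (R : forall t, rscopedb [length B] t = true ->
                        rrename 0 (gc_map keep) t = t).
  { intros t Ht. apply rrename_id. intros i Hi. apply gc_map_repeat_app; eauto. }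
  assert (E : root_step (Letrec (B ++ C) L)
    (Letrec (map (rrename 0 (gc_map keep)) (gc_keep keep (B ++ C)))
            (rrename 0 (gc_map keep) L))).
  { apply rs_gc.
    - unfold keep. now rewrite !length_app, !repeat_length.
    - unfold keep. apply in_or_app. right. destruct C; [congruence|simpl; auto].
    - intros i Hi. apply nth_repeat_app in Hi.
      assert (Hno : forall t, rscopedb [length B] t = true -> rocc 0 i t = false).
      { intros t Ht. destruct (rocc 0 i t) eqn:E; auto. specialize (Hs t i Ht E). lia. }
      split; auto. intros j b Hj Hk.
      destruct (Nat.lt_ge_cases j (length B)) as [Hlt|Hge].
      + rewrite nth_error_app1 in Hj by auto. apply Hno, HB.
        eapply nth_error_In; eauto.
      + unfold keep in Hk.
        assert (Hj' : j < length (B ++ C)) by (apply nth_error_Some; congruence).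
        rewrite length_app in Hj'.
        rewrite app_nth2, repeat_length in Hk by (now rewrite repeat_length).
        rewrite nth_repeat_lt in Hk by lia. discriminate. }
  unfold keep in E at 2. rewrite gc_keep_repeat_app, R in E by auto.
  replace (map (rrename 0 (gc_map keep)) B) with B in E; auto.
  rewrite <- (map_id B) at 1. apply map_ext_in. intros; symmetry; auto.
Qed.

(** Positive depths are left unconstrained, as head termination concerns depth 0 only. *)
Definition halt_obs (B : list term) : nat -> obs :=
  fun i d => d = 0 -> halts (Letrec B (RVar 0 i)).

(* Reducibility argument: head termination of the variables of [B] is one of
   the predicates [X] over which [productive] quantifies. *)
Lemma letrec_halts_rel n : forall b B,
  tsize b <= n ->
  (forall b', In b' B -> rscopedb [length B] b' = true) ->
  rscopedb [length B] b = true ->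
  productive botk b (scons (halt_obs B) botr) 0 -> halts (Letrec B b).
Proof.
  induction n as [|n IH]; intros b B Hn HB Hb Hp; [destruct b; simpl in Hn; lia|].
  destruct b as [i|t|t u|k i|bs L|c].
  - assert (H : halts (Letrec [] (Var i))).
    { apply (halts_step _ _ (rs_nil _)), halts_whnf. exact I. }
    destruct B as [|b0 B]; auto. eapply halts_step, H.
    apply (gc_suffix_step [] (b0 :: B)); [discriminate|intros ? []|reflexivity].
  - apply (halts_step _ _ (rs_lam _ _)), halts_whnf. exact I.
  - apply (halts_step _ _ (rs_app _ _ _)), halts_whnf. exact I.
  - destruct k as [|k]; [now apply Hp|contradiction].
  - eapply halts_step; [apply rs_nest|].
    set (m := length B). set (B' := B ++ map (merge_inner m 0) bs).
    assert (Hs' := root_step_scoped _ _ [] (rs_nest B bs L)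
                     (proj2 (rscoped_letrec _ _ _) (conj HB Hb))).
    fold m B' in Hs'. apply rscoped_letrec in Hs' as [HB' HL'].
    simpl in Hn.
    (* Halting facts move from [B] to [B']: an outer reference first discards the merged bindings
       and then halts in [B]. *)
    assert (M : forall t e,
      productive botk t (scons (fun i => halt_obs B' (m + i)) (scons (halt_obs B) botr)) e ->
      rscopedb [length bs; m] t = true ->
      productive botk (merge_inner m 0 t) (scons (halt_obs B') botr) e).
    { intros t e Ht Hst. rewrite (productive_rec_op _ (rec_op_merge_inner m)).
      revert Ht. apply productive_mono; auto. intros [|[|k]] i e' Ho; simpl; auto.
      intros Hh He. specialize (Hh He).
      destruct (rscoped_rocc _ _ _ _ Hst Ho) as (m' & E & Hlt).
      simpl in E. inversion E; subst m'.
      (* Without inner bindings [B'] is [B], and there is nothing to collect. *)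
      destruct bs as [|b0 bs]; [unfold B'; simpl; now rewrite app_nil_r|].
      eapply halts_step, Hh. apply gc_suffix_step; auto; [discriminate|].
      simpl. now apply Nat.ltb_lt. }
    apply rscoped_letrec in Hb as [Hbs HL]. fold m in Hbs, HL.
    apply IH; auto; fold m.
    + rewrite (tsize_rec_op _ (rec_op_merge_inner m)). lia.
    (* Halting of the inner variables in [B'] is prefixed for [bs]: the binding that [rs_rec]
       exposes is smaller than the letrec, so [IH] applies. *)
    + apply M; auto. rewrite productive_letrec in Hp. apply Hp.
      intros i b e Hi Hb He. subst e.
      assert (Hin := nth_error_In _ _ Hi).
      eapply halts_step.
      { apply rs_rec. unfold B'.
        rewrite nth_error_app2 by (fold m; lia). fold m.
        replace (m + i - m) with i by lia. now rewrite nth_error_map, Hi. }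
      fold B'. apply IH; auto.
      * rewrite (tsize_rec_op _ (rec_op_merge_inner m)).
        apply tsize_binding in Hin. lia.
      * apply HB', in_or_app. right. now apply in_map.
  - contradiction.
Qed.

Lemma productive_halts t : rscopedb [] t = true -> productive botk t botr 0 -> halts t.
Proof.
  intros Hs Hp. destruct t as [i|t|t u|k i|bs b|c];
    try (apply halts_whnf; exact I); try contradiction.
  apply rscoped_letrec in Hs as [Hbs Hb].
  apply (letrec_halts_rel _ b bs (le_n _)); auto.
  (* [halt_obs bs] is prefixed for [bs]: one unfolding leads from a variable to its binding, under
     the same halting hypotheses. *)
  rewrite productive_letrec in Hp. apply Hp.
  intros i b' e Hi Hp' ->. apply (halts_step _ _ (rs_rec _ _ _ Hi)).
  apply (letrec_halts_rel _ b' bs (le_n _)); auto.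
  apply Hbs. eapply nth_error_In; eauto.
Qed.

Definition good (t : term) : Prop :=
  rscopedb [] t = true /\ forall d, productive botk t botr d.

Definition good_whnf (t : term) : Prop :=
  match t with
  | Var _ => True
  | Lam u => good u
  | App u v => good u /\ good v
  | _ => False
  end.

Lemma good_reduces t :
  good t -> exists t', clos_refl_trans_1n term root_step t t' /\ good_whnf t'.
Proof.
  intros Hg. destruct (productive_halts t (proj1 Hg) (proj2 Hg 0)) as (t' & Hr & Hw).
  exists t'. split; auto.
  assert (Hg' : good t').
  { clear Hw. induction Hr as [t|t u t' Hs _ IH]; auto. apply IH.
    destruct Hg as [H1 H2].
    destruct (step_sound _ _ _ (st_root _ _ Hs) _ H1) as [H3 H4].
    split; auto. intros d. apply H4, H2. }
  destruct Hg' as [H1 H2]. destruct t' as [i|u|u v|k i|bs b|c]; auto; simpl in *.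
  - split; auto. intros d. apply (H2 (S d)).
  - apply andb_true_iff in H1 as [H1 H1'].
    repeat split; auto; intros d; apply (H2 (S d)).
Qed.

(** A choice function, so that [unfolding] and [normalize] take the same reduct at every node. *)
Definition head (t : term) : term :=
  epsilon (inhabits (Var 0))
    (fun t' => clos_refl_trans_1n term root_step t t' /\ good_whnf t').

Lemma head_spec t :
  good t -> clos_refl_trans_1n term root_step t (head t) /\ good_whnf (head t).
Proof. intros Hg. unfold head. apply epsilon_spec, good_reduces, Hg. Qed.

(** The default [IVar 0] is unreachable from a [good] term, by [head_spec]. *)
CoFixpoint unfolding (t : term) : iterm :=
  match head t with
  | Lam u => ILam (unfolding u)
  | App u v => IApp (unfolding u) (unfolding v)
  | Var i => IVar i
  | _ => IVar 0
  end.

Fixpoint normalize (D : nat) (t : term) : term :=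
  match D with
  | 0 => t
  | S D' =>
      match head t with
      | Lam u => Lam (normalize D' u)
      | App u v => App (normalize D' u) (normalize D' v)
      | t' => t'
      end
  end.

Definition iterm_unfold (M : iterm) : iterm :=
  match M with IVar i => IVar i | ILam N => ILam N | IApp N1 N2 => IApp N1 N2 end.

Lemma iterm_unfold_eq M : M = iterm_unfold M.
Proof. now destruct M. Qed.

Lemma agree_normalize D : forall t, good t -> agree D (normalize D t) (unfolding t).
Proof.
  induction D as [|D IH]; intros t Hg; [exact I|].
  rewrite (iterm_unfold_eq (unfolding t)).
  destruct (head_spec t Hg) as [_ Hw]. simpl.
  destruct (head t) as [i|u|u v|k i|bs b|c]; simpl in *; auto.
  destruct Hw; auto.
Qed.

(** The length is recorded because it bounds how long the concatenated reduction stays within one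
    stage. *)
Inductive steps_below (D : nat) : nat -> term -> term -> Prop :=
| sb_refl t : steps_below D 0 t t
| sb_step n d t u v :
    D <= d -> step d t u -> steps_below D n u v -> steps_below D (S n) t v.

Lemma steps_below_trans D n t u :
  steps_below D n t u -> forall m v, steps_below D m u v ->
  steps_below D (n + m) t v.
Proof. induction 1; intros; simpl; eauto using steps_below. Qed.

Lemma steps_below_map D n t u (f : term -> term) :
  (forall d t u, step d t u -> step (S d) (f t) (f u)) ->
  steps_below D n t u -> steps_below (S D) n (f t) (f u).
Proof.
  intros Hf. induction 1 as [|n d t u v Hd Hs _ IH]; [constructor|].
  apply (sb_step _ _ (S d) _ (f u)); auto. lia.
Qed.

(** Both terms share the head reducts of the first [D] levels, so only subterms at depth [D] are
    rewritten. *)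
Lemma normalize_steps D : forall t, good t ->
  exists n, steps_below D n (normalize D t) (normalize (S D) t).
Proof.
  induction D as [|D IH]; intros t Hg; destruct (head_spec t Hg) as [Hr Hw].
  - assert (E : normalize 1 t = head t) by (simpl; now destruct (head t)).
    rewrite E. simpl. clear E Hw.
    induction Hr as [|t u v Hs _ IH]; [exists 0; constructor|].
    destruct IH as [n Hn].
    { destruct Hg as [H1 H2].
      destruct (step_sound _ _ _ (st_root _ _ Hs) _ H1) as [H3 H4].
      split; auto. intros d. apply H4, H2. }
    exists (S n). apply (sb_step _ _ 0 _ u); auto. now constructor.
  - change (normalize (S (S D)) t) with
      (match head t with
       | Lam u => Lam (normalize (S D) u)
       | App u v => App (normalize (S D) u) (normalize (S D) v)
       | t' => t'
       end).
    change (normalize (S D) t) with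
      (match head t with
       | Lam u => Lam (normalize D u)
       | App u v => App (normalize D u) (normalize D v)
       | t' => t'
       end).
    destruct (head t) as [i|u|u v|k i|bs b|c]; simpl in Hw;
      try (exists 0; constructor).
    + destruct (IH u Hw) as [n Hn]. exists n.
      apply (steps_below_map D n _ _ Lam); auto. intros; now constructor.
    + destruct Hw as [Hu Hv].
      destruct (IH u Hu) as [n Hn], (IH v Hv) as [m Hm]. exists (n + m).
      eapply steps_below_trans.
      * apply (steps_below_map D n (normalize D u) (normalize (S D) u) (fun x => App x (normalize D v))); eauto.
        intros; now constructor.
      * apply (steps_below_map D m _ _ (App (normalize (S D) u))); auto.
        intros; now constructor.
Qed.

Lemma agree_step d t u : step d t u -> forall D M,
  D <= d -> agree D t M -> agree D u M.
Proof.
  induction 1; intros [|D] M HD HM; try exact I; try lia;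
    destruct M; simpl in *; try contradiction.
  - apply IHstep; auto; lia.
  - destruct HM. split; auto. apply IHstep; auto; lia.
  - destruct HM. split; auto. apply IHstep; auto; lia.
Qed.

Lemma agree_le D : forall D' t M, D <= D' -> agree D' t M -> agree D t M.
Proof.
  induction D as [|D IH]; intros [|D'] t M Hle HA; try exact I; [lia|].
  destruct t, M; simpl in *; auto; try contradiction.
  - apply (IH D'); auto; lia.
  - destruct HA; split; apply (IH D'); auto; lia.
Qed.

(** * Concatenating finite stages into one strongly convergent reduction *)

Section Concatenation.

Variables (T : nat -> term) (M : iterm).
Hypothesis T_steps : forall D, exists n, steps_below D n (T D) (T (S D)).
Hypothesis T_agree : forall D, agree D (T D) M.

Lemma steps_below_rt D n t u :
  steps_below D n t u -> clos_refl_trans term (fun a b => exists d, step d a b) t u.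
Proof.
  induction 1 as [|n d t u v _ Hs _ IH]; [apply rt_refl|].
  eapply rt_trans; [apply rt_step; eauto|apply IH].
Qed.

Record state := { st_term : term; st_phase : nat; st_left : nat }.

Definition state_inv (s : state) : Prop :=
  steps_below (st_phase s) (st_left s) (st_term s) (T (S (st_phase s))) /\
  agree (st_phase s) (st_term s) M.

(** The disjunction is lexicographic progress: within a stage the remaining count falls. The depth
    bound uses the new phase, since a step leaving a finished stage already belongs to a later
    one. *)
Definition state_next (s s' : state) : Prop :=
  (exists d, st_phase s' <= d /\ step d (st_term s) (st_term s')) /\
  state_inv s' /\
  (st_phase s < st_phase s' \/
   st_phase s' = st_phase s /\ st_left s = S (st_left s')).

Lemma state_next_total :
  (forall D, exists D', D <= D' /\ T D' <> T (S D')) ->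
  forall s, state_inv s -> exists s', state_next s s'.
Proof.
  intros Hinf [t D n] [Hs Ha]; simpl in *.
  inversion Hs as [t' E1 E2 E3|n' d t' u v Hd Hst Hr E1 E2 E3]; subst.
  (* The stage is used up. Stages on which [T] is constant are skipped, up to one that needs at
     least one step. *)
  - assert (Hnext : exists D', S D <= D' /\ T D' = T (S D) /\ T D' <> T (S D')).
    { destruct (Hinf (S D)) as (D' & Hle & Hne).
      assert (H : forall k D0, D0 + k = D' ->
        exists D1, D0 <= D1 /\ T D1 = T D0 /\ T D1 <> T (S D1)).
      { induction k as [|k IH]; intros D0 HD.
        - exists D0. replace D0 with D' by lia. auto.
        - destruct (classic (T D0 = T (S D0))) as [E|E]; [|exists D0; auto].
          destruct (IH (S D0)) as (D1 & H1 & H2 & H3); [lia|].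
          exists D1. rewrite E. repeat split; auto; lia. }
      apply (H (D' - S D)). lia. }
    destruct Hnext as (D' & Hle & E & Hne).
    destruct (T_steps D') as [n Hn].
    inversion Hn as [t' E1 E2 E3|n' d t' u v Hd Hst Hr E1 E2 E3]; subst; [congruence|].
    exists {| st_term := u; st_phase := D'; st_left := n' |}.
    split; [|split; [split|]]; simpl; auto.
    + exists d. rewrite <- E. auto.
    + eapply agree_step; eauto.
  - exists {| st_term := u; st_phase := D; st_left := n' |}.
    split; [|split; [split|]]; simpl; eauto.
    eapply agree_step; eauto.
Qed.

Lemma concatenation : expresses (T 0) M.
Proof.
  (* If [T] becomes stationary the reduction is finite, the first alternative of [expresses];
     otherwise stages with a step never run out. *)
  destruct (classic (exists D0, forall D, D0 <= D -> T D = T (S D))) as [[D0 H0]|Hinf].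
  - left. exists (T D0). split.
    + clear H0. induction D0 as [|D0 IH]; [apply rt_refl|].
      destruct (T_steps D0) as [n Hn].
      eapply rt_trans; [apply IH|eapply steps_below_rt; eauto].
    + assert (E : forall k, T (k + D0) = T D0).
      { induction k as [|k IH]; auto. rewrite <- IH. symmetry. apply H0. lia. }
      intros d. destruct (Nat.le_ge_cases d D0) as [Hle|Hge].
      * apply (agree_le d D0); auto.
      * rewrite <- (E (d - D0)). replace (d - D0 + D0) with d by lia. auto.
  - right.
    assert (Hinf' : forall D, exists D', D <= D' /\ T D' <> T (S D')).
    { intros D. apply NNPP. intros Hn. apply Hinf. exists D. intros D' HD.
      apply NNPP. intros Hne. apply Hn. eauto. }
    destruct (T_steps 0) as [n0 Hn0].
    set (s0 := {| st_term := T 0; st_phase := 0; st_left := n0 |}).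
    set (next := fun s => epsilon (inhabits s0) (state_next s)).
    set (sq := fun i => Nat.iter i next s0).
    assert (Hinv : forall i, state_inv (sq i)).
    { induction i as [|i IH]; [split; simpl; auto|].
      assert (H := epsilon_spec (inhabits s0) _ (state_next_total Hinf' _ IH)).
      apply H. }
    assert (Hnext : forall i, state_next (sq i) (sq (S i))).
    { intros i. apply (epsilon_spec (inhabits s0) _
                         (state_next_total Hinf' _ (Hinv i))). }
    clearbody next.
    assert (Hmono : forall i j, i <= j -> st_phase (sq i) <= st_phase (sq j)).
    { induction 1 as [|j _ IH]; auto. destruct (Hnext j) as (_ & _ & H). lia. }
    (* While the phase stands still the remaining count drops, so the phase must eventually rise. *)
    assert (Hgrow : forall n i, st_left (sq i) <= n ->
              exists j, st_phase (sq i) < st_phase (sq j)).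
    { induction n as [|n IH]; intros i Hi; destruct (Hnext i) as (_ & _ & H).
      - exists (S i). lia.
      - destruct H as [H|[H1 H2]]; [exists (S i); lia|].
        destruct (IH (S i)) as [j Hj]; [lia|]. exists j. lia. }
    assert (Hunb : forall D, exists N, forall i, N <= i -> D <= st_phase (sq i)).
    { induction D as [|D [N HN]]; [exists 0; lia|].
      destruct (Hgrow _ N (le_n _)) as [j Hj]. exists j. intros i Hi.
      specialize (HN N (le_n _)). specialize (Hmono j i Hi). lia. }
    assert (Hdep : forall i, exists d, st_phase (sq (S i)) <= d /\
              step d (st_term (sq i)) (st_term (sq (S i)))) by (intros i; apply Hnext).
    set (dep := fun i => epsilon (inhabits 0) (fun d => st_phase (sq (S i)) <= d /\
              step d (st_term (sq i)) (st_term (sq (S i))))).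
    assert (Hd := fun i => epsilon_spec (inhabits 0) _ (Hdep i)).
    exists (fun i => st_term (sq i)), dep. repeat split.
    + intros i. apply Hd.
    + intros D. destruct (Hunb D) as [N HN]. exists N. intros i Hi.
      transitivity (st_phase (sq (S i))); [apply HN; lia|apply Hd].
    + intros D. destruct (Hunb D) as [N HN]. exists N. intros i Hi.
      apply (agree_le D (st_phase (sq i))); [apply HN; lia|apply Hinv].
Qed.

End Concatenation.

Lemma productive_expresses L :
  rscopedb [] L = true -> (forall d, productive botk L botr d) -> exists M, expresses L M.
Proof.
  intros Hs Hp. assert (Hg : good L) by now split.
  exists (unfolding L).
  apply (concatenation (fun D => normalize D L)); intros D.
  - now apply normalize_steps.
  - now apply agree_normalize.
Qed.

(** * Access paths and productivity *)

Lemma deriv_nested_ind (Q : deriv -> Prop) :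
  (forall r n L kids, (forall k, In k kids -> Q k) -> Q (Node r n L kids)) ->
  forall d, Q d.
Proof.
  intros H. fix IH 1. intros [r n L kids]. apply H.
  induction kids as [|k kids IHk]; simpl; intros k' Hk; [tauto|].
  destruct Hk as [<-|Hk]; [apply IH | apply IHk, Hk].
Qed.

(** * Positions and discharging instances *)

Lemma node_at_app d p q :
  node_at d (p ++ q) =
  match node_at d p with Some d' => node_at d' q | None => None end.
Proof.
  revert d. induction p as [|j p IH]; intros [r n L kids]; simpl; auto.
  destruct (nth_error kids j); auto.
Qed.

Lemma node_at_snoc d p j r n L kids :
  node_at d p = Some (Node r n L kids) -> node_at d (p ++ [j]) = nth_error kids j.
Proof.
  intros H. rewrite node_at_app, H. simpl. now destruct (nth_error kids j).
Qed.

Definition ancestor (q p : list nat) : Prop := exists j s, p = q ++ j :: s.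

Lemma ancestor_snoc q p j : ancestor q (p ++ [j]) <-> q = p \/ ancestor q p.
Proof.
  split.
  - intros (j' & s & E). destruct s as [|x s _] using rev_ind.
    + left. now apply app_inj_tail in E as [-> _].
    + right. rewrite app_comm_cons, app_assoc in E.
      apply app_inj_tail in E as [-> _]. now exists j', s.
  - intros [->|(j' & s & ->)].
    + now exists j, [].
    + exists j', (s ++ [j]). now rewrite <- app_assoc.
Qed.

Lemma ancestor_neq q p : ancestor q p -> q <> p.
Proof.
  intros (j & s & E) ->. apply (f_equal (@length nat)) in E.
  rewrite length_app in E. simpl in E. lia.
Qed.

Lemma ancestor_trans q r p : ancestor q r -> ancestor r p -> ancestor q p.
Proof.
  intros (j & s & ->) (j' & s' & ->). exists j, (s ++ j' :: s').
  now rewrite <- app_assoc.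
Qed.

Lemma ancestor_firstn k p : k < length p -> ancestor (firstn k p) p.
Proof.
  intros H. rewrite <- (firstn_skipn k p) at 2.
  destruct (skipn k p) as [|j s] eqn:E; [|now exists j, s].
  apply (f_equal (@length nat)) in E. rewrite length_skipn in E. simpl in E. lia.
Qed.

Lemma ancestor_node d q p nd :
  ancestor q p -> node_at d p = Some nd -> exists nd', node_at d q = Some nd'.
Proof.
  intros (j & s & ->) H. rewrite node_at_app in H.
  destruct (node_at d q); [eauto|discriminate].
Qed.

Lemma disch_aux_snoc p : forall d c acc here j r n L kids,
  node_at d p = Some (Node r n L kids) -> nth_error kids j <> None ->
  disch_aux d (p ++ [j]) c acc here =
  match r with
  | RFix cs => if existsb (Nat.eqb c) cs then Some (here ++ p)
               else disch_aux d p c acc here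
  | _ => disch_aux d p c acc here
  end.
Proof.
  induction p as [|j0 p IH]; intros [r0 n0 L0 kids0] c acc here j r n L kids H Hj.
  - simpl in H. inversion H; subst. simpl. rewrite app_nil_r.
    destruct (nth_error kids j); [|congruence]. now destruct r.
  - simpl in *. destruct (nth_error kids0 j0); [|discriminate].
    rewrite (IH _ _ _ _ _ _ _ _ _ H Hj), <- app_assoc. reflexivity.
Qed.

(** [disch] scans from the root, whereas positions grow at their far end; the last node passed is
    the innermost candidate and takes precedence. *)
Lemma disch_snoc d p c j r n L kids :
  node_at d p = Some (Node r n L kids) -> nth_error kids j <> None ->
  disch d (p ++ [j]) c =
  match r with
  | RFix cs => if existsb (Nat.eqb c) cs then Some p else disch d p c
  | _ => disch d p c
  end.
Proof. intros H Hj. unfold disch. now rewrite (disch_aux_snoc _ _ _ _ _ _ _ _ _ _ H Hj). Qed.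

Lemma existsb_eqb c cs : existsb (Nat.eqb c) cs = true <-> In c cs.
Proof.
  rewrite existsb_exists. split.
  - intros (x & Hx & E). apply Nat.eqb_eq in E. now subst.
  - intros H. exists c. split; auto. apply Nat.eqb_refl.
Qed.

Lemma disch_spec d c q p : forall nd,
  node_at d p = Some nd -> disch d p c = Some q ->
  ancestor q p /\
  exists cs n L kids, node_at d q = Some (Node (RFix cs) n L kids) /\ In c cs.
Proof.
  induction p as [|j p IH] using rev_ind; intros nd Hp Hd; [discriminate|].
  rewrite ancestor_snoc.
  destruct (node_at d p) as [[r n L kids]|] eqn:E;
    [|rewrite node_at_app, E in Hp; discriminate].
  rewrite (node_at_snoc _ _ _ _ _ _ _ E) in Hp.
  rewrite (disch_snoc _ _ _ _ _ _ _ _ E) in Hd by congruence.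
  assert (K : disch d p c = Some q -> (q = p \/ ancestor q p) /\
    exists cs n L kids, node_at d q = Some (Node (RFix cs) n L kids) /\ In c cs).
  { intros H. destruct (IH _ eq_refl H). auto. }
  destruct r; auto. destruct (existsb (Nat.eqb c) cs) eqn:Ec; auto.
  inversion Hd; subst. apply existsb_eqb in Ec. eauto 8.
Qed.

Definition guarding (d : deriv) (p : list nat) : bool :=
  match node_at d p with
  | Some (Node RLam _ _ _) | Some (Node RApp _ _ _) => true
  | _ => false
  end.

(* [live d p e]: every access path from [p] is either finite or passes [e + 1]
   instances of (lambda) or (@). *)
Inductive live (d : deriv) : list nat -> nat -> Prop :=
| live_intro p e :
    (forall q e', amove d p q ->
       (if guarding d p then e = S e' else e = e') -> live d q e') ->
    live d p e.

Lemma live_next d p q e :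
  live d p e -> amove d p q ->
  forall e', (if guarding d p then e = S e' else e = e') -> live d q e'.
Proof. destruct 1; eauto. Qed.

Lemma live_pred d p e : live d p (S e) -> live d p e.
Proof.
  intros H. remember (S e) as e1 eqn:E. revert e E.
  induction H as [p e1 H IH]; intros e ->. constructor. intros q e' Hm He.
  apply (IH q (S e')); auto. destruct (guarding d p); congruence.
Qed.

Lemma unguarded_move_iff d p q :
  unguarded_move d p q <-> amove d p q /\ guarding d p = false.
Proof.
  unfold unguarded_move, guarding.
  destruct (node_at d p) as [[[]]|]; intuition discriminate.
Qed.

Definition all_nodes_ok (d : deriv) : Prop :=
  forall p nd, node_at d p = Some nd -> node_ok nd.

(* The meaning of the constant [c] at position [p], where [K] gives the meaning
   of the premises of the FIX instances.  Constants may be reused by several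
   instances, so this depends on [p]. *)
Definition kap (d : deriv) (K : list nat -> obs) (p : list nat) : nat -> obs :=
  fun c e => exists q cs n L kids i,
    disch d p c = Some q /\ node_at d q = Some (Node (RFix cs) n L kids) /\
    nth_error cs i = Some c /\ K (q ++ [i]) e.

Definition fix_rule (r : rule) : bool :=
  match r with RFix _ => true | _ => false end.

Lemma kap_nonfix d K p j r n L kids :
  node_at d p = Some (Node r n L kids) -> nth_error kids j <> None ->
  fix_rule r = false ->
  forall c e, kap d K (p ++ [j]) c e <-> kap d K p c e.
Proof.
  intros Hp Hj Hr c e. unfold kap. rewrite (disch_snoc _ _ _ _ _ _ _ _ Hp Hj).
  destruct r; try discriminate; reflexivity.
Qed.

Lemma productive_kap_ext d K t p q e rho :
  (forall c e, kap d K p c e <-> kap d K q c e) ->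
  productive (kap d K p) t rho e <-> productive (kap d K q) t rho e.
Proof. intros H. split; apply productive_mono; auto; intros; now apply H. Qed.

Lemma kap_fix_in d K p j cs n L kids i c e :
  node_at d p = Some (Node (RFix cs) n L kids) -> nth_error kids j <> None ->
  NoDup cs -> nth_error cs i = Some c ->
  kap d K (p ++ [j]) c e <-> K (p ++ [i]) e.
Proof.
  intros Hp Hj Hnd Hi. unfold kap. rewrite (disch_snoc _ _ _ _ _ _ _ _ Hp Hj).
  rewrite (proj2 (existsb_eqb c cs)) by (eapply nth_error_In; eauto).
  split.
  - intros (q & cs' & n' & L' & kids' & i' & E & Hq & Hi' & HK).
    inversion E; subst. rewrite Hp in Hq. inversion Hq; subst.
    replace i with i'; auto.
    apply (proj1 (NoDup_nth_error cs') Hnd).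
    + apply nth_error_Some. congruence.
    + congruence.
  - intros HK. exists p, cs, n, L, kids, i. auto.
Qed.

Lemma kap_fix_out d K p j cs n L kids c e :
  node_at d p = Some (Node (RFix cs) n L kids) -> nth_error kids j <> None ->
  ~ In c cs ->
  kap d K (p ++ [j]) c e <-> kap d K p c e.
Proof.
  intros Hp Hj Hc. unfold kap. rewrite (disch_snoc _ _ _ _ _ _ _ _ Hp Hj).
  destruct (existsb (Nat.eqb c) cs) eqn:E; [|reflexivity].
  now apply existsb_eqb in E.
Qed.

(** Read through [kap] at a premise, the constants [cs] play the recursion variables they replace;
    freshness leaves the constants already in [b] with their outer meaning. *)
Lemma productive_fix_premise d K p j cs n L kids b e :
  node_at d p = Some (Node (RFix cs) n L kids) -> nth_error kids j <> None ->
  NoDup cs -> rscopedb [length cs] b = true ->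
  (forall c, In c cs -> hasc c b = false) ->
  productive (kap d K (p ++ [j])) (rsubst cs 0 b) botr e <->
  productive (kap d K p) b (scons (fun i => K (p ++ [i])) botr) e.
Proof.
  intros Hp Hj Hnd Hs Hc.
  rewrite (productive_rec_op _ (rec_op_rsubst cs)).
  assert (Hk : forall c e, hasc c b = true ->
            kap d K (p ++ [j]) c e <-> kap d K p c e).
  { intros c e' Hh. apply (kap_fix_out _ _ _ _ _ _ _ _ _ _ Hp Hj).
    intros Hin. rewrite Hc in Hh; congruence. }
  assert (Hr : forall k i e, rocc k i b = true ->
    productive (kap d K (p ++ [j])) (rsubst cs 0 (RVar k i)) botr e <->
    scons (fun i => K (p ++ [i])) botr k i e).
  { intros k i e' Ho. destruct (rscoped_rocc _ _ _ _ Hs Ho) as (m & E & Hlt).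
    destruct k as [|[|k]]; try discriminate. simpl in E. inversion E; subst m.
    cbn [rsubst Nat.eqb]. destruct (nth_error cs i) as [c|] eqn:Ei.
    - apply (kap_fix_in _ _ _ _ _ _ _ _ _ _ _ Hp Hj Hnd Ei).
    - apply nth_error_None in Ei. lia. }
  split; apply productive_mono; intros; try apply Hk; try apply Hr; auto.
Qed.

Lemma assm_move_unique d p c n L kids q1 q2 :
  all_nodes_ok d ->
  node_at d p = Some (Node (RAssm c) n L kids) ->
  amove d p q1 -> amove d p q2 -> q1 = q2.
Proof.
  intros Hok Hp. unfold amove. rewrite Hp.
  intros (r & cs & i & n1 & L1 & k1 & Hd & Hr & Hi & ->)
         (r' & cs' & i' & n2 & L2 & k2 & Hd' & Hr' & Hi' & ->).
  rewrite Hd in Hd'. inversion Hd'; subst r'.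
  rewrite Hr in Hr'. inversion Hr'; subst.
  destruct (Hok _ _ Hr) as (_ & _ & bs & body & _ & _ & Hnd & _).
  f_equal. f_equal. apply (proj1 (NoDup_nth_error cs') Hnd).
  - apply nth_error_Some. congruence.
  - congruence.
Qed.

Lemma fix_node_facts cs n L kids :
  node_ok (Node (RFix cs) n L kids) ->
  exists bs body, L = Letrec bs body /\ length cs = length bs /\ NoDup cs /\
    (forall b, In b bs \/ b = body ->
       rscopedb [length cs] b = true /\ forall c, In c cs -> hasc c b = false) /\
    (forall j b, nth_error bs j = Some b ->
       exists r L' k, nth_error kids j = Some (Node r n L' k) /\ L' = rsubst cs 0 b) /\
    (exists r L' k, nth_error kids (length cs) = Some (Node r n L' k) /\
       L' = rsubst cs 0 body).
Proof.
  intros (_ & Hs & bs & body & -> & Hlen & Hnd & Hfr & _ & Hb & Hbody).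
  exists bs, body. rewrite Hlen. apply rscoped_letrec in Hs as [Hs1 Hs2].
  repeat split; auto.
  - destruct H as [H| ->]; auto.
  - intros c Hc. destruct (Hfr c Hc), H as [H| ->]; auto.
  - intros j b Hj. destruct (Hb j b Hj) as ([r n' L' k] & Hk & E).
    simpl in E. inversion E; subst. eauto.
  - destruct Hbody as ([r n' L' k] & Hk & E). simpl in E. inversion E; subst. eauto.
Qed.

(* With [K := live d], liveness of the premises of a FIX instance is itself a
   prefixed point. *)
Lemma productive_live d : all_nodes_ok d ->
  forall nd p, node_at d p = Some nd ->
  forall e, productive (kap d (live d) p) (snd (kconcl nd)) botr e -> live d p e.
Proof.
  intros Hok nd. induction nd as [r n L kids IH] using deriv_nested_ind.
  intros p Hp e HP. simpl in HP.
  assert (IH' : forall j r' n' L' k', nth_error kids j = Some (Node r' n' L' k') ->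
    forall e, productive (kap d (live d) (p ++ [j])) L' botr e -> live d (p ++ [j]) e).
  { intros j r' n' L' k' Hj e'. apply (IH (Node r' n' L' k')).
    - eapply nth_error_In; eauto.
    - now rewrite (node_at_snoc _ _ _ _ _ _ _ Hp). }
  assert (HN := Hok _ _ Hp).
  constructor. intros q e' Hm. unfold guarding. rewrite Hp. intros He.
  destruct r as [|c| | | |cs].
  - unfold amove in Hm. rewrite Hp in Hm. contradiction.
  - subst e'. destruct HN as (_ & _ & _ & ->).
    destruct HP as (q' & cs & n' & L' & kids' & i & Hd & Hq & Hi & HK).
    replace q with (q' ++ [i]); auto.
    apply (assm_move_unique d p c n (Cst c) kids _ _ Hok Hp); auto.
    unfold amove. rewrite Hp. eauto 10.
  - destruct HN as (_ & _ & [r' n' L' k'] & L0 & -> & E & ->). simpl in E.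
    inversion E; subst. unfold amove in Hm. rewrite Hp in Hm. subst q.
    eapply IH'; [reflexivity|].
    apply (productive_kap_ext _ _ _ _ p); auto.
    apply (kap_nonfix _ _ _ _ _ _ _ _ Hp); [discriminate|auto].
  - destruct HN as (_ & _ & [r' n' L' k'] & [r1 n1 L1' k1] & L0 & L1 & -> & E & E1 & ->).
    simpl in E, E1. inversion E; inversion E1; subst.
    unfold amove in Hm. rewrite Hp in Hm. destruct HP as [HP0 HP1].
    destruct Hm as [-> | ->]; (eapply IH'; [reflexivity|]);
      (apply (productive_kap_ext _ _ _ _ p); [|assumption]);
      (apply (kap_nonfix _ _ _ _ _ _ _ _ Hp); [discriminate|auto]).
  - destruct HN as (_ & _ & [r' n' L' k'] & m & L0 & -> & -> & E & ->). simpl in E.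
    inversion E; subst. unfold amove in Hm. rewrite Hp in Hm. subst q.
    eapply IH'; [reflexivity|]. apply productive_lshift in HP.
    apply (productive_kap_ext _ _ _ _ p); auto.
    apply (kap_nonfix _ _ _ _ _ _ _ _ Hp); [discriminate|auto].
  - subst e'. unfold amove in Hm. rewrite Hp in Hm. subst q.
    destruct (fix_node_facts _ _ _ _ HN)
      as (bs & body & -> & Hlen & Hnd & Hfr & Hbs & r' & L' & k' & Hk & ->).
    eapply IH'; [exact Hk|].
    apply (productive_fix_premise _ _ _ _ _ _ _ _ _ _ Hp); auto; try apply Hfr; auto;
      [congruence|].
    rewrite productive_letrec in HP. apply HP. intros i b e' Hi Hb.
    destruct (Hbs i b Hi) as (r'' & L'' & k'' & Hk'' & ->).
    eapply IH'; [exact Hk''|].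
    apply nth_error_In in Hi.
    apply (productive_fix_premise _ _ _ _ _ _ _ _ _ _ Hp); auto; try apply Hfr; auto.
    congruence.
Qed.

(** The strict ancestors of [p] include every FIX instance that can discharge an assumption at
    [p]. *)
Definition prefixed_at (d : deriv) (K : list nat -> obs) (p : list nat) : Prop :=
  forall q cs n L kids i r' n' L' kids', ancestor q p ->
    node_at d q = Some (Node (RFix cs) n L kids) -> i < length cs ->
    node_at d (q ++ [i]) = Some (Node r' n' L' kids') ->
    forall e, productive (kap d K (q ++ [i])) L' botr e -> K (q ++ [i]) e.

Lemma prefixed_at_nonfix d K p j r n L kids :
  node_at d p = Some (Node r n L kids) -> fix_rule r = false ->
  prefixed_at d K p -> prefixed_at d K (p ++ [j]).
Proof.
  intros Hp Hr HK q cs n' L' kids' i r1 n1 L1 k1 Ha Hq.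
  apply ancestor_snoc in Ha as [->|Ha].
  - rewrite Hp in Hq. inversion Hq; subst. discriminate.
  - eapply HK; eauto.
Qed.

Lemma kap_ext d K K' p nd c e :
  node_at d p = Some nd ->
  (forall q i e, ancestor q p -> K (q ++ [i]) e -> K' (q ++ [i]) e) ->
  kap d K p c e -> kap d K' p c e.
Proof.
  intros Hp H (q & cs & n & L & kids & i & Hd & Hq & Hi & HK).
  exists q, cs, n, L, kids, i. repeat split; auto.
  apply H; auto. eapply disch_spec; eauto.
Qed.

(** Induction on [live], because an access path jumps from an assumption to a premise that is not a
    subderivation. [K] stays quantified, as each FIX instance overrides it at its own premises. *)
Lemma live_productive d : all_nodes_ok d -> assumptions_ok d ->
  forall p e, live d p e ->
  forall r n L kids, node_at d p = Some (Node r n L kids) ->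
  forall K, prefixed_at d K p -> productive (kap d K p) L botr e.
Proof.
  intros Hok Has p e Hl. induction Hl as [p e _ IH]. intros r n L kids Hp K HK.
  assert (HN := Hok _ _ Hp). unfold guarding in IH. rewrite Hp in IH.
  destruct r as [|c| | | |cs].
  - destruct HN as (_ & _ & _ & m & _ & ->). exact I.
  - destruct HN as (_ & _ & _ & ->).
    destruct (Has _ _ _ _ _ Hp) as (q & cs & nq & Lq & kq & Hd & Hq & _ & _).
    destruct (disch_spec _ _ _ _ _ Hp Hd) as (Ha & cs' & n' & L' & k' & Hq' & Hin).
    rewrite Hq in Hq'. inversion Hq'; subst cs' n' L' k'.
    apply In_nth_error in Hin as [i Hi].
    exists q, cs, nq, Lq, kq, i. repeat split; auto.
    destruct (fix_node_facts _ _ _ _ (Hok _ _ Hq))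
      as (bs & body & -> & Hlen & Hnd & Hfr & Hbs & _).
    assert (Hlt : i < length cs) by (apply nth_error_Some; congruence).
    destruct (nth_error bs i) as [b|] eqn:Eb; [|apply nth_error_None in Eb; lia].
    destruct (Hbs i b Eb) as (r' & L' & k' & Hk & EL).
    assert (Hqi : node_at d (q ++ [i]) = Some (Node r' nq L' k'))
      by (now rewrite (node_at_snoc _ _ _ _ _ _ _ Hq)).
    (* Being prefixed reduces the constant to the premise it stands for, and that premise is live
       because the path jumps there. *)
    apply (HK _ _ _ _ _ _ _ _ _ _ Ha Hq Hlt Hqi).
    apply (IH (q ++ [i]) e) with (r := r') (n := nq) (kids := k'); auto.
    + unfold amove. rewrite Hp. eauto 10.
    + intros q0 cs0 n0 L0 k0 i0 r1 n1 L1 k1 Ha0. apply ancestor_snoc in Ha0 as [->|Ha0].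
      * apply HK; auto.
      * apply HK. eapply ancestor_trans; eauto.
  - destruct HN as (_ & _ & [r' n' L' k'] & L0 & -> & E & ->). simpl in E.
    inversion E; subst. destruct e as [|e]; [exact I|]. simpl.
    apply (productive_kap_ext _ _ _ p (p ++ [0])).
    { intros. symmetry. apply (kap_nonfix _ _ _ _ _ _ _ _ Hp); [discriminate|auto]. }
    eapply IH; eauto.
    + unfold amove. now rewrite Hp.
    + now rewrite (node_at_snoc _ _ _ _ _ _ _ Hp).
    + eapply prefixed_at_nonfix; eauto.
  - destruct HN as (_ & _ & [r' n' L' k'] & [r1 n1 L1' k1] & L0 & L1 & -> & E & E1 & ->).
    simpl in E, E1. inversion E; inversion E1; subst.
    destruct e as [|e]; [exact I|]. simpl. split.
    + apply (productive_kap_ext _ _ _ p (p ++ [0])).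
      { intros. symmetry. apply (kap_nonfix _ _ _ _ _ _ _ _ Hp); [discriminate|auto]. }
      eapply IH; eauto.
      * unfold amove. rewrite Hp. auto.
      * now rewrite (node_at_snoc _ _ _ _ _ _ _ Hp).
      * eapply prefixed_at_nonfix; eauto.
    + apply (productive_kap_ext _ _ _ p (p ++ [1])).
      { intros. symmetry. apply (kap_nonfix _ _ _ _ _ _ _ _ Hp); [discriminate|auto]. }
      eapply IH; eauto.
      * unfold amove. rewrite Hp. auto.
      * now rewrite (node_at_snoc _ _ _ _ _ _ _ Hp).
      * eapply prefixed_at_nonfix; eauto.
  - destruct HN as (_ & _ & [r' n' L' k'] & m & L0 & -> & -> & E & ->). simpl in E.
    inversion E; subst. apply productive_lshift.
    apply (productive_kap_ext _ _ _ p (p ++ [0])).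
    { intros. symmetry. apply (kap_nonfix _ _ _ _ _ _ _ _ Hp); [discriminate|auto]. }
    eapply IH; eauto.
    + unfold amove. now rewrite Hp.
    + now rewrite (node_at_snoc _ _ _ _ _ _ _ Hp).
    + eapply prefixed_at_nonfix; eauto.
  - destruct (fix_node_facts _ _ _ _ HN)
      as (bs & body & -> & Hlen & Hnd & Hfr & Hbs & r' & L' & k' & Hk & EL').
    apply productive_letrec. intros X HX.
    (* Overriding [K] by [X] at the premises of [p] is the counterpart of extending an environment
       by [scons]. *)
    set (K' := fun q e => (exists i, q = p ++ [i] /\ X i e) \/
                          ((forall i, q <> p ++ [i]) /\ K q e)).
    assert (KX : forall i e, K' (p ++ [i]) e <-> X i e).
    { intros i e0. split; [|left; eauto].
      intros [(i' & E & H)|[H _]]; [|now destruct (H i)].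
      now apply app_inj_tail in E as [_ ->]. }
    assert (KK : forall q i e, q <> p -> K' (q ++ [i]) e <-> K (q ++ [i]) e).
    { intros q i e0 Hne. split.
      - intros [(i' & E & _)|[_ H]]; auto. now apply app_inj_tail in E as [-> _].
      - intros H. right. split; auto. intros i' E.
        now apply app_inj_tail in E as [-> _]. }
    assert (Hprem : forall j b e, nth_error kids j <> None -> In b bs \/ b = body ->
      productive (kap d K' (p ++ [j])) (rsubst cs 0 b) botr e ->
      productive (kap d K p) b (scons X botr) e).
    { intros j b e0 Hj Hb H. destruct (Hfr b Hb).
      apply (productive_fix_premise _ _ _ _ _ _ _ _ _ _ Hp) in H; auto.
      revert H. apply productive_mono.
      - intros c e1 _. eapply kap_ext; eauto. intros q i e2 Ha.
        apply KK. now apply ancestor_neq.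
      - intros [|k] i e1 _; simpl; auto. apply KX. }
    apply (Hprem (length cs)); [congruence|auto|].
    rewrite <- EL'. eapply IH; auto.
    + unfold amove. now rewrite Hp.
    + rewrite (node_at_snoc _ _ _ _ _ _ _ Hp). exact Hk.
    + intros q cs0 n0 L0 k0 i r1 n1 L1 k1 Ha Hq Hi Hqi e0 H.
      apply ancestor_snoc in Ha as [->|Ha].
      * rewrite Hp in Hq. inversion Hq; subst cs0 n0 L0 k0. apply KX.
        destruct (nth_error bs i) as [b|] eqn:Eb; [|apply nth_error_None in Eb; lia].
        destruct (Hbs i b Eb) as (r2 & L2 & k2 & Hk2 & EL2).
        rewrite (node_at_snoc _ _ _ _ _ _ _ Hp), Hk2 in Hqi.
        inversion Hqi; subst.
        apply (HX i b e0 Eb). apply (Hprem i); auto; [congruence|].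
        left. eapply nth_error_In; eauto.
      * apply KK; [now apply ancestor_neq|].
        apply (HK _ _ _ _ _ _ _ _ _ _ Ha Hq Hi Hqi). revert H.
        apply productive_mono; auto. intros c e1 _. eapply kap_ext; eauto.
        intros q' i' e2 Ha'. apply KK. apply ancestor_neq.
        apply ancestor_snoc in Ha' as [->|Ha']; auto.
        eapply ancestor_trans; eauto.
Qed.

(** * Guardedness on access path cycles and liveness *)

(** Without cycles a node once entered is never met again, so each move shrinks the finite list of
    candidates. *)
Lemma acyclic_acc {A : Type} (eq_dec : forall x y : A, {x = y} + {x <> y})
  (R : A -> A -> Prop) : forall n (l : list A) x,
  length l <= n ->
  (forall y, clos_trans A R x y -> In y l) ->
  (forall y, clos_trans A R x y -> ~ clos_trans A R y y) ->
  Acc (fun a b => R b a) x.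
Proof.
  induction n as [|n IH]; intros l x Hn Hin Hac; constructor; intros y Hy.
  - destruct l; [|simpl in Hn; lia].
    destruct (Hin y). now apply t_step.
  - assert (Hxy : clos_trans A R x y) by now apply t_step.
    apply (IH (remove eq_dec y l)).
    + assert (length (remove eq_dec y l) < length l)
        by (apply remove_length_lt; auto). lia.
    + intros z Hz. apply in_in_remove.
      * intros ->. now apply (Hac y).
      * apply Hin. now apply t_trans with y.
    + intros z Hz. apply Hac. now apply t_trans with y.
Qed.

Lemma acc_acyclic {A : Type} (R : A -> A -> Prop) x :
  Acc (fun a b => R b a) x -> ~ clos_trans A R x x.
Proof.
  intros H.
  assert (H1 : Acc (fun a b => clos_trans A R b a) x).
  { apply Acc_clos_trans in H. revert H. apply Acc_incl. intros a b Hab.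
    induction Hab; [now apply t_step|eapply t_trans; eauto]. }
  induction H1 as [y _ IH]. intros Hc. now apply (IH y Hc).
Qed.

Fixpoint positions (d : deriv) : list (list nat) :=
  match d with
  | Node _ _ _ kids =>
      [] :: flat_map (fun j => map (cons j) (nth j (map positions kids) []))
                     (seq 0 (length kids))
  end.

Lemma positions_complete d : forall p nd, node_at d p = Some nd -> In p (positions d).
Proof.
  induction d as [r n L kids IH] using deriv_nested_ind.
  intros [|j p] nd H; simpl in *; auto. right.
  destruct (nth_error kids j) as [k|] eqn:E; [|discriminate].
  apply in_flat_map. exists j. split.
  - apply in_seq. split; [lia|]. apply nth_error_Some. congruence.
  - rewrite (nth_error_nth (map positions kids) j [] (x := positions k))
      by (now rewrite nth_error_map, E).
    apply in_map. eapply IH; eauto. eapply nth_error_In; eauto.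
Qed.

Lemma amove_node d p q :
  all_nodes_ok d -> amove d p q -> exists nd, node_at d q = Some nd.
Proof.
  intros Hok Hm. unfold amove in Hm.
  destruct (node_at d p) as [[r n L kids]|] eqn:Hp; [|contradiction].
  assert (HN := Hok _ _ Hp). destruct r as [|c| | | |cs].
  - contradiction.
  - destruct Hm as (q' & cs & i & n' & L' & kids' & _ & Hq & Hi & ->).
    rewrite (node_at_snoc _ _ _ _ _ _ _ Hq).
    destruct (fix_node_facts _ _ _ _ (Hok _ _ Hq))
      as (bs & body & _ & Hlen & _ & _ & Hbs & _).
    assert (Hlt : i < length cs) by (apply nth_error_Some; congruence).
    destruct (nth_error bs i) as [b|] eqn:Eb; [|apply nth_error_None in Eb; lia].
    destruct (Hbs i b Eb) as (? & ? & ? & ? & _). eauto.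
  - destruct HN as (_ & _ & k & L0 & -> & _). subst q.
    rewrite (node_at_snoc _ _ _ _ _ _ _ Hp). simpl. eauto.
  - destruct HN as (_ & _ & k0 & k1 & L0 & L1 & -> & _).
    destruct Hm as [-> | ->]; rewrite (node_at_snoc _ _ _ _ _ _ _ Hp); simpl; eauto.
  - destruct HN as (_ & _ & k & m & L0 & -> & _). subst q.
    rewrite (node_at_snoc _ _ _ _ _ _ _ Hp). simpl. eauto.
  - subst q. rewrite (node_at_snoc _ _ _ _ _ _ _ Hp).
    destruct (fix_node_facts _ _ _ _ HN)
      as (bs & body & _ & _ & _ & _ & _ & ? & ? & ? & ? & _). eauto.
Qed.

Lemma unguarded_amove d p q :
  clos_trans _ (unguarded_move d) p q -> clos_refl_trans _ (amove d) p q.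
Proof.
  induction 1 as [p q [H _]|p q r _ IH1 _ IH2]; [now apply rt_step|].
  eapply rt_trans; eauto.
Qed.

(** Two nested inductions: on the budget [e] for guarded moves and, at a fixed budget, on
    accessibility under unguarded moves, available because a derivation has finitely many
    positions. *)
Lemma guarded_live d b :
  all_nodes_ok d -> guarded_from d b ->
  forall e p, clos_refl_trans _ (amove d) b p -> live d p e.
Proof.
  intros Hok Hg. induction e as [e IHe] using lt_wf_ind. intros p Hp.
  assert (Hacc : Acc (fun x y => unguarded_move d y x) p).
  { apply (acyclic_acc (list_eq_dec Nat.eq_dec) (unguarded_move d)
             _ (positions d) p (le_n _)).
    - intros y Hy.
      assert (Hn : exists nd, node_at d y = Some nd).
      { clear - Hy Hok. induction Hy as [p q [H _]|p q r _ _ _ IH]; auto.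
        eapply amove_node; eauto. }
      destruct Hn as [nd Hn]. eapply positions_complete; eauto.
    - intros y Hy. apply Hg. eapply rt_trans; [exact Hp|]. now apply unguarded_amove. }
  induction Hacc as [p _ IH]. constructor. intros q e' Hm He.
  assert (Hq : clos_refl_trans _ (amove d) b q)
    by (eapply rt_trans; [exact Hp|now apply rt_step]).
  destruct (guarding d p) eqn:E.
  - apply IHe; auto; lia.
  - subst e'. apply IH; auto. now apply unguarded_move_iff.
Qed.

Lemma bottommost_iff d p :
  bottommost_fix d p <->
  (exists nd, node_at d p = Some nd /\ is_fix nd = true) /\
  (forall q nd, ancestor q p -> node_at d q = Some nd -> is_fix nd = false).
Proof.
  unfold bottommost_fix. split; intros [(nd & Hp & Hf) H]; split; eauto.
  - intros q nd' (j & s & ->) Hq. destruct (H (length q)) as (nd1 & H1 & H2).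
    + rewrite length_app. simpl. lia.
    + rewrite firstn_app, Nat.sub_diag, firstn_all, app_nil_r in H1. congruence.
  - intros k Hk. assert (Ha := ancestor_firstn k p Hk).
    destruct (ancestor_node _ _ _ _ Ha Hp) as [nd' Hq]. eauto.
Qed.

(** Guardedness is given only from bottommost FIX instances on. A position with no FIX instance at
    or below it is treated by structural induction: no assumption is discharged there, so its moves
    only go upwards. *)
Lemma deriv_ok_live d : deriv_ok d -> forall e, live d [] e.
Proof.
  intros (Hok & Has & Hg).
  assert (H : forall nd p, node_at d p = Some nd ->
    (forall q nd', ancestor q p -> node_at d q = Some nd' -> is_fix nd' = false) ->
    forall e, live d p e).
  { intros nd. induction nd as [r n L kids IH] using deriv_nested_ind.
    intros p Hp Hanc e.
    destruct (is_fix (Node r n L kids)) eqn:Hf.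
    { apply (guarded_live d p); auto; [|apply rt_refl].
      apply Hg, bottommost_iff. split; eauto. }
    assert (IH' : forall j e, amove d p (p ++ [j]) -> live d (p ++ [j]) e).
    { intros j e0 Hm. destruct (amove_node _ _ _ Hok Hm) as [k Hk].
      apply (IH k); auto.
      - rewrite (node_at_snoc _ _ _ _ _ _ _ Hp) in Hk. eapply nth_error_In; eauto.
      - intros q nd' Ha Hq. apply ancestor_snoc in Ha as [->|Ha]; [|eauto].
        rewrite Hp in Hq. now inversion Hq; subst. }
    constructor. intros q e' Hm _. assert (Hm' := Hm).
    unfold amove in Hm'. rewrite Hp in Hm'. destruct r as [|c| | | |cs].
    - contradiction.
    - destruct Hm' as (q' & cs & i & n' & L' & k' & Hd & Hq & _).
      destruct (disch_spec _ _ _ _ _ Hp Hd) as (Ha & _).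
      specialize (Hanc _ _ Ha Hq). discriminate.
    - subst q. auto.
    - destruct Hm' as [-> | ->]; auto.
    - subst q. auto.
    - discriminate. }
  intros e. apply (H d []); auto.
  intros q nd (j & s & E). now destruct q.
Qed.

(** Access paths from the root avoid only binding premises of FIX instances, and none lies below
    such a [p]. *)
Lemma nonfix_reach d p : all_nodes_ok d -> forall nd,
  node_at d p = Some nd ->
  (forall q nd', ancestor q p -> node_at d q = Some nd' -> is_fix nd' = false) ->
  clos_refl_trans _ (amove d) [] p.
Proof.
  intros Hok. induction p as [|j p IH] using rev_ind; intros nd Hp Hanc; [apply rt_refl|].
  assert (Ha : ancestor p (p ++ [j])) by (apply ancestor_snoc; auto).
  destruct (ancestor_node _ _ _ _ Ha Hp) as [[r n L kids] Hp'].
  apply rt_trans with p.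
  - apply (IH _ Hp'). intros q nd' Hq. apply Hanc. eapply ancestor_trans; eauto.
  - apply rt_step. assert (HN := Hok _ _ Hp'). specialize (Hanc _ _ Ha Hp').
    rewrite (node_at_snoc _ _ _ _ _ _ _ Hp') in Hp.
    unfold amove. rewrite Hp'. destruct r as [|c| | | |cs]; try discriminate Hanc.
    + destruct HN as (_ & _ & -> & _). destruct j; discriminate.
    + destruct HN as (_ & _ & -> & _). destruct j; discriminate.
    + destruct HN as (_ & _ & k & L0 & -> & _).
      destruct j as [|[|j]]; auto; discriminate.
    + destruct HN as (_ & _ & k0 & k1 & L0 & L1 & -> & _).
      destruct j as [|[|[|j]]]; auto; discriminate.
    + destruct HN as (_ & _ & k & m & L0 & -> & _).
      destruct j as [|[|j]]; auto; discriminate.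
Qed.

Lemma live_guarded d b :
  all_nodes_ok d -> (forall e, live d [] e) -> bottommost_fix d b -> guarded_from d b.
Proof.
  intros Hok Hl Hb p Hp.
  apply bottommost_iff in Hb as [(nd & Hn & _) Hanc].
  assert (Hroot : clos_refl_trans _ (amove d) [] p)
    by (eapply rt_trans; [eapply nonfix_reach; eauto|exact Hp]).
  (* All budgets are kept, since each guarded move on the way costs one. *)
  assert (H : forall e, live d p e).
  { clear - Hroot Hl. apply clos_rt_rt1n in Hroot.
    induction Hroot as [x|x y z Hm _ IH]; auto. apply IH.
    intros e. assert (H := live_next _ _ _ _ (Hl (S e)) Hm).
    destruct (guarding d x); [now apply H|]. apply live_pred. now apply H. }
  (* Unguarded moves leave the budget fixed, so [live] yields accessibility under them, which
     excludes a cycle. *)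
  apply acc_acyclic. specialize (H 0). clear - H. remember 0 as e eqn:E.
  induction H as [p e _ IH]. constructor. intros q Hq.
  apply unguarded_move_iff in Hq as [Hm Hg]. apply (IH q e); auto.
  now rewrite Hg.
Qed.

Lemma deriv_ok_productive d n L :
  kconcl d = (n, L) -> deriv_ok d -> forall e, productive botk L botr e.
Proof.
  intros Hc Hd e. assert (Hl := deriv_ok_live _ Hd e).
  destruct Hd as (Hok & Has & _). destruct d as [r n' L' kids].
  simpl in Hc. inversion Hc; subst.
  (* The root has no ancestors, so the empty assignment is admissible and no constant receives a
     meaning. *)
  assert (H := live_productive _ Hok Has _ _ Hl r n L kids eq_refl (fun _ _ => False)).
  eapply productive_mono; [| |apply H].
  - intros c e' _ (q & cs & n1 & L1 & k1 & i & _ & _ & _ & []).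
  - auto.
  - intros q cs n1 L1 k1 i r' n' L' k' (j & s & E). now destruct q.
Qed.

Lemma productive_deriv_ok d n L :
  kconcl d = (n, L) -> all_nodes_ok d -> assumptions_ok d ->
  (forall e, productive botk L botr e) -> deriv_ok d.
Proof.
  intros Hc Hok Has Hp. split; [|split]; auto. intros b Hb.
  apply live_guarded; auto. intros e.
  apply (productive_live d Hok d []); auto. rewrite Hc. simpl.
  generalize (Hp e). apply productive_mono; auto. intros c e' _ [].
Qed.

(** * Canonical derivations *)

Lemma hasc_rsubst cs c t : forall l,
  hasc c (rsubst cs l t) = true -> In c cs \/ hasc c t = true.
Proof.
  induction t as [i|t IH|t u IHt IHu|k i|bs b IHbs IHb|x] using term_nested_ind;
    intros l H; auto.
  - apply (IH l), H.
  - simpl in *. apply orb_true_iff in H as [H|H].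
    + destruct (IHt _ H) as [|E]; auto. rewrite E. auto.
    + destruct (IHu _ H) as [|E]; auto. rewrite E, orb_true_r. auto.
  - simpl in H. destruct (k =? l); [|destruct (l <? k); discriminate].
    destruct (nth_error cs i) as [c'|] eqn:E; [|discriminate].
    apply Nat.eqb_eq in H. subst. left. eapply nth_error_In; eauto.
  - simpl in *. apply orb_true_iff in H as [H|H].
    + apply existsb_exists in H as (b' & Hb & H).
      apply in_map_iff in Hb as (b0 & <- & Hb).
      destruct (IHbs _ Hb _ H) as [|E]; auto. right. apply orb_true_iff. left.
      apply existsb_exists. eauto.
    + destruct (IHb _ H) as [|E]; auto. rewrite E, orb_true_r. auto.
Qed.

Lemma lclosed_rsubst cs t : forall l n,
  lclosedb n t = true -> lclosedb n (rsubst cs l t) = true.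
Proof.
  induction t as [i|t IH|t u IHt IHu|k i|bs b IHbs IHb|x] using term_nested_ind;
    intros l n H; auto; simpl in *.
  - now apply IH.
  - apply andb_true_iff in H as [H1 H2]. now rewrite IHt, IHu.
  - destruct (k =? l); [|destruct (l <? k); reflexivity].
    destruct (nth_error cs i); reflexivity.
  - apply andb_true_iff in H as [H1 H2]. rewrite IHb, andb_true_r by auto.
    rewrite forallb_forall in *. intros b' Hb.
    apply in_map_iff in Hb as (b0 & <- & Hb). auto.
Qed.

Lemma rscoped_rsubst cs t :
  rscopedb [length cs] t = true -> rscopedb [] (rsubst cs 0 t) = true.
Proof.
  intros H. apply (rscoped_rec_op _ (rec_op_rsubst cs) t 0 _ _ H).
  intros [|[|k]] i _ (m & E & Hlt); try discriminate. simpl in E. inversion E; subst.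
  simpl. destruct (nth_error cs i) eqn:Ei; auto.
  apply nth_error_None in Ei. lia.
Qed.

Lemma disch_aux_acc p : forall d c acc here nd,
  node_at d p = Some nd ->
  disch_aux d p c acc here =
  match disch d p c with Some q => Some (here ++ q) | None => acc end.
Proof.
  unfold disch.
  induction p as [|j p IH]; intros [r n L kids] c acc here nd H; auto.
  simpl in *. destruct (nth_error kids j) as [k|]; [|discriminate].
  rewrite (IH k c _ (here ++ [j]) nd H).
  rewrite (IH k c _ [j] nd H).
  destruct (disch_aux k p c None []) as [q|]; [now rewrite <- app_assoc|].
  destruct r; auto. destruct (existsb (Nat.eqb c) cs); auto.
  now rewrite app_nil_r.
Qed.

Definition discharged (r : rule) : list nat :=
  match r with RFix cs => cs | _ => [] end.

(** The root-end counterpart of [disch_snoc], for adding a node below finished derivations: an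
    instance inside the kid is nearer to the leaf and wins. *)
Lemma disch_cons r n L kids j p c k nd :
  nth_error kids j = Some k -> node_at k p = Some nd ->
  disch (Node r n L kids) (j :: p) c =
  match disch k p c with
  | Some q => Some (j :: q)
  | None => if existsb (Nat.eqb c) (discharged r) then Some [] else None
  end.
Proof.
  intros Hj Hp. unfold disch at 1. simpl. rewrite Hj, (disch_aux_acc _ _ _ _ _ _ Hp).
  destruct (disch k p c); auto. now destruct r.
Qed.

Definition thread_ok (d : deriv) (p : list nat) (lo n : nat) : Prop :=
  forall k, lo <= k <= length p ->
    exists nd, node_at d (firstn k p) = Some nd /\ n <= prefix_len nd.

(* Side condition (1) for a derivation [d] with open assumptions: an open
   assumption on [c] has prefix length [pf c], and [c] occurs in [t]. *)
Definition open_assumptions_ok (pf : nat -> nat) (t : term) (d : deriv) : Prop :=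
  forall p c n L kids, node_at d p = Some (Node (RAssm c) n L kids) ->
    (exists q cs Lq kq,
       disch d p c = Some q /\ node_at d q = Some (Node (RFix cs) n Lq kq) /\
       thread_ok d p (S (length q)) n) \/
    (disch d p c = None /\ n = pf c /\ hasc c t = true /\ thread_ok d p 0 n).

(** A constant that stays open still occurs in the conclusion, so [pf c <= n] extends its thread
    through the root. The constants of a FIX root are discharged at its own prefix length [n]. *)
Lemma open_assumptions_node pf r n L kids :
  match r with RAssm _ => False | _ => True end ->
  (forall c, hasc c L = true -> pf c <= n) ->
  (forall k, In k kids -> exists t,
     open_assumptions_ok
       (fun c => if existsb (Nat.eqb c) (discharged r) then n else pf c) t k /\
     forall c, hasc c t = true -> In c (discharged r) \/ hasc c L = true) ->
  open_assumptions_ok pf L (Node r n L kids).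
Proof.
  intros Hr Hpf Hkids [|j p] c n' L' kids' H.
  - simpl in H. inversion H; subst. contradiction.
  - simpl in H. destruct (nth_error kids j) as [k|] eqn:Hj; [|discriminate].
    destruct (Hkids k (nth_error_In _ _ Hj)) as (t & Ht & Hc).
    rewrite (disch_cons _ _ _ _ _ _ _ _ _ Hj H).
    assert (Hth : forall lo, thread_ok k p lo n' ->
              thread_ok (Node r n L kids) (j :: p) (S lo) n').
    { intros lo Hlo [|i] Hi; [lia|]. simpl in *. rewrite Hj.
      apply Hlo. lia. }
    destruct (Ht _ _ _ _ _ H) as [(q & cs & Lq & kq & Hd & Hq & Hthr)
                                 |(Hd & Hn & Hh & Hthr)]; rewrite Hd.
    + left. exists (j :: q), cs, Lq, kq. simpl. rewrite Hj. auto.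
    + destruct (existsb (Nat.eqb c) (discharged r)) eqn:Ec.
      * left. subst n'. destruct r; try discriminate.
        exists [], cs, L, kids. simpl. auto.
      * right.
        assert (Hh' : hasc c L = true).
        { destruct (Hc c Hh) as [Hin|]; auto.
          apply existsb_eqb in Hin. congruence. }
        repeat split; auto.
        intros [|i] Hi; [|apply (Hth 0 Hthr); lia].
        exists (Node r n L kids). split; auto. subst n'. apply Hpf, Hh'.
Qed.

Lemma all_nodes_ok_node r n L kids :
  node_ok (Node r n L kids) -> (forall k, In k kids -> all_nodes_ok k) ->
  all_nodes_ok (Node r n L kids).
Proof.
  intros H Hk [|j p] nd E.
  - simpl in E. now inversion E; subst.
  - simpl in E. destruct (nth_error kids j) as [k|] eqn:Ej; [|discriminate].
    apply (Hk k (nth_error_In _ _ Ej) p), E.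
Qed.

Definition canonical (pf : nat -> nat) (n : nat) (t : term) (d : deriv) : Prop :=
  kconcl d = (n, t) /\ all_nodes_ok d /\ open_assumptions_ok pf t d.

Lemma canonical_node pf r n L kids :
  match r with RAssm _ => False | _ => True end ->
  (forall c, hasc c L = true -> pf c <= n) ->
  node_ok (Node r n L kids) ->
  (forall k, In k kids -> exists n' t,
     canonical (fun c => if existsb (Nat.eqb c) (discharged r) then n else pf c) n' t k /\
     forall c, hasc c t = true -> In c (discharged r) \/ hasc c L = true) ->
  canonical pf n L (Node r n L kids).
Proof.
  intros Hr Hpf Hok Hk. split; [|split]; auto.
  - apply all_nodes_ok_node; auto. intros k Hin.
    destruct (Hk k Hin) as (n' & t & (_ & H & _) & _). auto.
  - apply open_assumptions_node; auto.
    intros k Hin. destruct (Hk k Hin) as (n' & t & (_ & _ & H) & Hc). eauto.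
Qed.

Lemma canonical_var pf i : forall n, i < n -> exists d, canonical pf n (Var i) d.
Proof.
  induction i as [|i IH]; intros n Hn.
  - exists (Node RAx n (Var 0) []). apply canonical_node; simpl; auto.
    + discriminate.
    + repeat split; auto; [now apply Nat.ltb_lt|]. exists (n - 1). split; auto; lia.
    + tauto.
  - destruct n as [|n]; [lia|]. destruct (IH n) as [d Hd]; [lia|].
    exists (Node RDel (S n) (Var (S i)) [d]).
    apply canonical_node; simpl; auto; [discriminate| |].
    + repeat split; auto; [now apply Nat.ltb_lt|].
      exists d, n, (Var i). repeat split; auto. apply Hd.
    + intros k [<-|[]]. exists n, (Var i). split; auto.
Qed.

(** The [m] prefix variables in excess of the discharging instance are removed by (del+), so that
    the assumption gets exactly the prefix length required. *)
Lemma canonical_cst pf c m : exists d, canonical pf (m + pf c) (Cst c) d.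
Proof.
  induction m as [|m [d Hd]].
  - exists (Node (RAssm c) (pf c) (Cst c) []). split; [|split]; auto.
    + apply all_nodes_ok_node; simpl; auto. tauto.
    + intros [|[|j] p] c' n L kids H; simpl in H; try discriminate.
      inversion H; subst. right. repeat split; auto.
      * simpl. apply Nat.eqb_refl.
      * intros [|k] Hk; simpl in *; [eauto|lia].
  - exists (Node RDel (S m + pf c) (Cst c) [d]).
    apply canonical_node; simpl; auto.
    + intros c' H. apply Nat.eqb_eq in H. subst. lia.
    + repeat split; auto. exists d, (m + pf c), (Cst c). repeat split; auto. apply Hd.
    + intros k [<-|[]]. exists (m + pf c), (Cst c). split; auto.
Qed.

Lemma list_choice {A B : Type} (R : A -> B -> Prop) l :
  (forall x, In x l -> exists y, R x y) ->
  exists ys, length ys = length l /\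
    (forall j x, nth_error l j = Some x -> exists y, nth_error ys j = Some y /\ R x y) /\
    (forall y, In y ys -> exists x, In x l /\ R x y).
Proof.
  induction l as [|x l IH]; intros H.
  - exists []. repeat split; auto.
    + intros [|j]; discriminate.
    + intros y [].
  - destruct (H x (or_introl eq_refl)) as [y Hy].
    destruct IH as (ys & H1 & H2 & H3); [intros; apply H; simpl; auto|].
    exists (y :: ys). simpl. repeat split; auto.
    + intros [|j] x' E; simpl in *; [|eauto]. inversion E; subst; eauto.
    + intros y' [<-|Hin]; [eauto|]. destruct (H3 _ Hin) as (x' & ? & ?). eauto.
Qed.

(** Induction on a size bound, because FIX premises are images under [rsubst]. All constants of [t]
    lie below [m], so those from [m] on are fresh for the next letrec. *)
Lemma canonical_exists s : forall t m n pf,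
  tsize t <= s -> lclosedb n t = true -> rscopedb [] t = true ->
  (forall c, hasc c t = true -> c < m) ->
  (forall c, hasc c t = true -> pf c <= n) ->
  exists d, canonical pf n t d.
Proof.
  induction s as [|s IH]; intros t m n pf Hs Hl Hr Hm Hpf;
    [destruct t; simpl in Hs; lia|].
  destruct t as [i|t|t u|k i|bs b|c].
  - apply canonical_var. now apply Nat.ltb_lt.
  - simpl in Hs. destruct (IH t m (S n) pf) as [d Hd]; auto; [lia|].
    exists (Node RLam n (Lam t) [d]). apply canonical_node; auto.
    + split; [|split]; auto. exists d, t. repeat split. apply Hd.
    + intros k [<-|[]]. exists (S n), t. split; auto.
  - simpl in Hs, Hl, Hr, Hm, Hpf.
    apply andb_true_iff in Hl as [Hl1 Hl2], Hr as [Hr1 Hr2].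
    setoid_rewrite orb_true_iff in Hm. setoid_rewrite orb_true_iff in Hpf.
    destruct (IH t m n pf) as [d Hd]; auto; [lia|].
    destruct (IH u m n pf) as [d' Hd']; auto; [lia|].
    exists (Node RApp n (App t u) [d; d']). apply canonical_node; auto.
    + simpl. setoid_rewrite orb_true_iff. auto.
    + split; [|split]; simpl; try (now apply andb_true_iff).
      exists d, d', t, u. repeat split; [apply Hd|apply Hd'].
    + simpl. setoid_rewrite orb_true_iff.
      intros k [<-|[<-|[]]]; [exists n, t|exists n, u]; split; auto.
  - simpl in Hr. destruct k; discriminate.
  - set (cs := seq m (length bs)).
    assert (Hlen : length cs = length bs) by apply length_seq.
    set (pf' := fun c => if existsb (Nat.eqb c) cs then n else pf c).
    simpl in Hs. apply rscoped_letrec in Hr as [Hr1 Hr2].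
    assert (Hl' := Hl). simpl in Hl'. apply andb_true_iff in Hl' as [Hl1 Hl2].
    rewrite forallb_forall in Hl1.
    assert (Hsub : forall b', In b' (bs ++ [b]) ->
      tsize b' <= s /\ lclosedb n b' = true /\ rscopedb [length cs] b' = true /\
      forall c, hasc c b' = true -> hasc c (Letrec bs b) = true).
    { intros b' Hb. rewrite Hlen. apply in_app_or in Hb as [Hb|[<-|[]]].
      - repeat split; auto.
        + apply tsize_binding in Hb. lia.
        + intros c Hc. simpl. apply orb_true_iff. left. apply existsb_exists; eauto.
      - repeat split; auto; [lia|].
        intros c Hc. simpl. rewrite Hc. apply orb_true_r. }
    assert (Hfresh : forall c b', In b' (bs ++ [b]) -> In c cs -> hasc c b' = false).
    { intros c b' Hb Hc. apply in_seq in Hc. destruct (hasc c b') eqn:E; auto.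
      apply (Hsub b' Hb) in E. apply Hm in E. lia. }
    (* Bindings followed by the body: the order of the premises of a FIX node. *)
    destruct (list_choice (fun b' d => canonical pf' n (rsubst cs 0 b') d) (bs ++ [b]))
      as (kids & Hk1 & Hk2 & Hk3).
    { intros b' Hb. destruct (Hsub b' Hb) as (H1 & H2 & H3 & H4).
      apply (IH _ (m + length bs)).
      - now rewrite (tsize_rec_op _ (rec_op_rsubst cs)).
      - now apply lclosed_rsubst.
      - now apply rscoped_rsubst.
      - intros c Hc. apply hasc_rsubst in Hc as [Hc|Hc].
        + apply in_seq in Hc. lia.
        + apply H4, Hm in Hc. lia.
      - intros c Hc. unfold pf'. destruct (existsb (Nat.eqb c) cs) eqn:E; auto.
        apply hasc_rsubst in Hc as [Hc|Hc]; auto.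
        apply existsb_eqb in Hc. congruence. }
    exists (Node (RFix cs) n (Letrec bs b) kids).
    apply canonical_node; auto.
    + split; [|split]; auto; [now apply rscoped_letrec|].
      exists bs, b. repeat split; auto.
      * apply seq_NoDup.
      * apply Hfresh; auto. apply in_or_app; simpl; auto.
      * intros b' Hb. apply Hfresh; auto. apply in_or_app; auto.
      * rewrite Hk1, length_app. simpl. lia.
      * intros j b' Hj. destruct (Hk2 j b') as (k & Hk & Hc & _); eauto.
        rewrite nth_error_app1; auto. apply nth_error_Some; congruence.
      * destruct (Hk2 (length bs) b) as (k & Hk & Hc & _); eauto.
        now rewrite nth_error_app2, Nat.sub_diag by lia.
    + intros k Hk. destruct (Hk3 k Hk) as (b' & Hb & Hc).
      exists n, (rsubst cs 0 b'). split; [exact Hc|].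
      intros c Hh. apply hasc_rsubst in Hh as [Hh|Hh]; auto.
      right. now apply (Hsub b' Hb).
  - assert (Hle : pf c <= n) by (apply Hpf; simpl; apply Nat.eqb_refl).
    destruct (canonical_cst pf c (n - pf c)) as [d Hd].
    exists d. now replace (n - pf c + pf c) with n in Hd by lia.
Qed.

Lemma canonical_derivation L :
  closed_letrec_term L ->
  exists d, kconcl d = (0, L) /\ all_nodes_ok d /\ assumptions_ok d.
Proof.
  intros (Hl & Hr & Hc).
  destruct (canonical_exists _ L 0 0 (fun _ => 0) (le_n _) Hl Hr) as (d & H1 & H2 & H3);
    [intros c; rewrite Hc; discriminate ..|].
  exists d. repeat split; auto. intros p c n L' kids Hp.
  destruct (H3 _ _ _ _ _ Hp) as [(q & cs & Lq & kq & Hd & Hq & Hth)|(_ & _ & Hh & _)].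
  - exists q, cs, n, Lq, kq. repeat split; auto.
  - rewrite Hc in Hh. discriminate.
Qed.

Theorem mainTheorem7 (L : term) :
  closed_letrec_term L ->
  ((exists M : iterm, expresses L M) <-> derivable 0 L).
Proof.
  intros HL. assert (Hr : rscopedb [] L = true) by apply HL. split.
  - intros [M HM].
    destruct (canonical_derivation L HL) as (d & Hc & Hok & Has).
    exists d. split; auto. apply (productive_deriv_ok d 0 L); auto.
    now apply (expresses_productive L M).
  - intros (d & Hc & Hd). apply productive_expresses; auto.
    now apply (deriv_ok_productive d 0 L).
Qed.
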